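(* Let $F:[a,b]\times\mathbb R^d\to\mathbb R^d$ be such that: (1) for every $x\in\mathbb R^d$, $t\mapsto F(t,x)$ is $\mu_g$-measurable; (2) for $\mu_g$-a.e. $t$, $x\mapsto F(t,x)$ is continuous; (3) there exist nonnegative $m,L\in L_g^1([a,b))$ such that $\|F(t,0)\|\le m(t)$ and $\|F(t,x)-F(t,y)\|\le L(t)\|x-y\|$ for $\mu_g$-a.e. $t$ and all $x,y\in\mathbb R^d$. Then for every $u_0\in\mathbb R^d$ there exists a unique integral solution $U\in AC_g([a,b];\mathbb R^d)$ of $D_gU=F(t,U)$, $U(a)=u_0$, i.e. a unique $U\in AC_g([a,b];\mathbb R^d)$ with $$U(t)=u_0+\int_{[a,t)}F(s,U(s))\,d\mu_g(s),\qquad t\in[a,b].$$ This function is also the unique global weak solution with initial trace $u_0$ and final trace $U(b)$.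
   Context: Let $\mathbb F$ be $\mathbb R$ or $\mathbb C$, let $a<b$ be real, $d\in\mathbb N$, and let $g:[a,b]\to\mathbb R$ be nondecreasing and left-continuous. $\mu_g$ is the finite Lebesgue--Stieltjes measure on $[a,b)$ with $\mu_g([s,t))=g(t)-g(s)$ for $a\le s\le t\le b$. Standing assumption: $M_g:=\mu_g([a,b))=g(b)-g(a)>0$. For $1\le p\le\infty$, $L_g^p([a,b))$ is the $L^p$ space of $\mathbb F$-valued functions for the completion of $\mu_g$ (modulo $\mu_g$-a.e. equality); measurability is with respect to this completion; vector-valued spaces and integrals are understood componentwise. $J_g:=\{t\in[a,b):\Delta g(t):=g(t^+)-g(t)>0\}$ is the set of jump points. $AC_g([a,b])$ is the set of $u:[a,b]\to\mathbb F$ such that for every $\varepsilon>0$ there is $\delta>0$ such that, for every finite family of pairwise disjoint intervals $[a_j,b_j)\subset[a,b)$, $\sum_j(g(b_j)-g(a_j))<\delta$ implies $\sum_j|u(b_j)-u(a_j)|<\varepsilon$. It is known that $u\in AC_g([a,b])$ if and only if there is $v\in L_g^1([a,b))$ with $u(t)=u(a)+\int_{[a,t)}v\,d\mu_g$ for all $t\in[a,b]$; $v$ is unique $\mu_g$-a.e. and the Stieltjes derivative is $D_gu:=v$. $AC_g([a,b];\mathbb R^d)$ is understood componentwise. Posterior trace: $S_g\varphi(t):=\varphi(t^+)$ if $t\in J_g$ and $S_g\varphi(t):=\varphi(t)$ otherwise. Test space: $\mathcal T_g$ is the set of $\varphi:[a,b]\to\mathbb F$ of the form $\varphi(t)=c+\int_{[a,t)}\psi\,d\mu_g$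 with $c\in\mathbb F$, $\psi\in L_g^\infty([a,b))$ (so $D_g\varphi=\psi$). Global weak solution with initial trace $u_0$ and final trace $u_b$: a state $([u],u_0,u_b)$ with $u\in L_g^1([a,b);\mathbb R^d)$, $u_0,u_b\in\mathbb R^d$, such that $F(\cdot,u(\cdot))\in L_g^1$ and, for every $\varphi\in\mathcal T_g$ (componentwise identity), $$\int_{[a,b)}u\,D_g\varphi\,d\mu_g+\int_{[a,b)}F(t,u(t))\,S_g\varphi(t)\,d\mu_g(t)=u_b\varphi(b)-u_0\varphi(a).$$ A function $U$ is regarded as a weak solution through the state $([U],U(a),U(b))$. *)

(* Defs.v *)
From HB Require Import structures.
From mathcomp Require Import all_boot all_order all_algebra.
From mathcomp Require Import all_classical all_reals all_analysis.
From mathcomp Require Import complex.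
Set Implicit Arguments.
Unset Strict Implicit.
Unset Printing Implicit Defensive.
Import Order.TTheory GRing.Theory Num.Theory.
Import numFieldNormedType.Exports.
Local Open Scope classical_set_scope.
Local Open Scope ring_scope.

(* Functions on [a, b] are encoded as total functions on R; their values
   outside [a, b] are never used. *)
Record derivator (R : realType) (a b : R) := Derivator {
  derivator_fun :> R -> R;
  derivator_le : forall s t, a <= s -> s <= t -> t <= b ->
    derivator_fun s <= derivator_fun t;
  derivator_left_continuous : forall t, a < t -> t <= b ->
    derivator_fun x @[x --> t^'-] --> derivator_fun t }.

Section stieltjes_measure.
Context (R : realType) (a b : R) (g : derivator a b).

Definition gclamp (x : R) : R := g (Num.max a (Num.min x b)).

(* The library builds Stieltjes measures from right-continuous functions f,
   with mass f t - f s on ]s, t]. The measure of the left-continuous g, with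
   mass g t - g s on [s, t[ (lemma mug_itv below), is the one obtained from
   f x := g(x^+). Clamping puts no mass outside [a, b[. *)
Definition gplus (x : R) : R := inf (gclamp @` `]x, +oo[).

Lemma gclamp_le x y : x <= y -> gclamp x <= gclamp y.
Proof.
move=> xy; have [ba|ab] := ltP b a.
  rewrite /gclamp !(max_idPl _)//.
  - by rewrite ge_min (ltW ba) orbT.
  - by rewrite ge_min (ltW ba) orbT.
have xyb : Num.min x b <= Num.min y b.
  by rewrite le_min !ge_min xy lexx orbT.
apply: derivator_le.
- by rewrite le_max lexx.
- by rewrite ge_max !le_max lexx /= xyb orbT.
- by rewrite ge_max ab ge_min lexx orbT.
Qed.

Let gclamp_lb x : lbound (gclamp @` `]x, +oo[) (gclamp x).
Proof.
move=> z [y /=]; rewrite in_itv/= andbT => /ltW xy <-; exact: gclamp_le.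
Qed.

Let gclamp_has_inf x : has_inf (gclamp @` `]x, +oo[).
Proof.
split; last by exists (gclamp x); exact: gclamp_lb.
by exists (gclamp (x + 1)), (x + 1) => //=; rewrite in_itv/= ltrDl ltr01.
Qed.

Lemma gclamp_le_gplus x : gclamp x <= gplus x.
Proof. by apply: lb_le_inf; [exact: (gclamp_has_inf x).1|exact: gclamp_lb]. Qed.

Lemma gplus_le_gclamp x y : x < y -> gplus x <= gclamp y.
Proof.
move=> xy; apply: ge_inf; first exact: (gclamp_has_inf x).2.
by exists y => //=; rewrite in_itv/= andbT.
Qed.

Let gplus_nondecreasing : nondecreasing gplus.
Proof.
move=> x y; rewrite le_eqVlt => /predU1P[->//|xy].
exact: le_trans (gplus_le_gclamp xy) (gclamp_le_gplus y).
Qed.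

Let gplus_right_continuous : right_continuous gplus.
Proof.
move=> x; apply/cvgrPdist_lt => e e0.
have [_ [y /= xy <-]] := inf_adherent e0 (gclamp_has_inf x).
rewrite -/(gplus x) in_itv/= andbT in xy * => ye.
near=> z.
rewrite distrC ger0_norm ?subr_ge0; last by apply: gplus_nondecreasing.
rewrite ltrBlDl (le_lt_trans _ ye)// gplus_le_gclamp//.
Unshelve. all: by end_near. Qed.

HB.instance Definition _ := isCumulative.Build R _ R gplus
  gplus_nondecreasing gplus_right_continuous.

Definition stieltjes_type : Type := caratheodory_type (wlength gplus)^*%mu.
HB.instance Definition _ := Measurable.on stieltjes_type.

Definition mug : {measure set stieltjes_type -> \bar R} :=
  completed_lebesgue_stieltjes_measure gplus.

Let mug_oc x y : x <= y -> mug `]x, y]%classic = (gplus y - gplus x)%:E.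
Proof.
move=> xy; rewrite /mug/= /completed_lebesgue_stieltjes_measure.
rewrite /completed_measure_extension measurable_mu_extE/=; last exact: is_ocitv.
by rewrite wlength_itv_bnd.
Qed.

Let mug_measurable_itv (i : interval R) :
  measurable ([set` i] : set stieltjes_type).
Proof. apply: sub_caratheodory; exact: measurable_itv. Qed.

Let gclamp_left t : t <= b -> gclamp x @[x --> t^'-] --> gclamp t.
Proof.
move=> tb; have [ta|at_] := leP t a.
  have gE x : x <= t -> gclamp x = g a.
    move=> xt; rewrite /gclamp (max_idPl _)// ge_min.
    by rewrite (le_trans xt ta).
  rewrite (gE t)//; apply: cvg_near_cst; near=> x; rewrite gE//.
  Unshelve. 2: by end_near.
have gE x : a <= x -> x <= t -> gclamp x = g x.
  move=> ax xt; rewrite /gclamp (min_idPl _) ?(le_trans xt)//.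
  by rewrite (max_idPr _).
rewrite (gE t)// ?ltW//.
apply: cvg_trans (derivator_left_continuous (d := g) at_ tb).
apply: near_eq_cvg; near=> x; rewrite gE//.
  by near: x; exact: nbhs_left_ge.
Unshelve. all: by end_near. Qed.

Let mug_oo x t : x < t -> t <= b ->
  mug `]x, t[%classic = (gclamp t - gplus x)%:E.
Proof.
move=> xt tb.
pose r (n : nat) := t - (t - x) / n.+1%:R.
have rt n : r n < t by rewrite /r ltrBlDr ltrDl divr_gt0// subr_gt0.
have rx n : x <= r n.
  rewrite /r lerBrDr addrC -lerBrDr ler_pdivrMr//.
  by rewrite ler_peMr ?subr_ge0 ?(ltW xt)// ler1n.
have rcvg : r n @[n --> \oo] --> t.
  rewrite -[X in _ --> X]subr0; apply: cvgB; first exact: cvg_cst.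
  rewrite -[X in _ --> X](mulr0 (t - x)); apply: cvgM; first exact: cvg_cst.
  exact: cvg_harmonic.
have rcvgl : r n @[n --> \oo] --> t^'-.
  move=> A At; have /= := rcvg (fun y => y < t -> A y) At.
  by apply: (@filterS nat \oo _ (fun n => r n < t -> A (r n))) => n; apply.
have UE : `]x, t[%classic = \bigcup_n (`]x, r n]%classic : set R).
  apply/seteqP; split => [y|y [n _]] /=; rewrite !in_itv/=.
    move=> /andP[xy yt].
    have : \forall n \near \oo, y < r n by apply: cvgr_gt yt.
    move=> [n _ /(_ n)/= ynr]; exists n => //=.
    by rewrite in_itv/= xy/= ltW// ynr//.
  by move=> /andP[-> /le_lt_trans]; apply.
have c1 : (mug \o (fun n => `]x, r n]%classic : set R)) n @[n --> \oo] -->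
          mug `]x, t[%classic.
  rewrite UE; apply: nondecreasing_cvg_mu.
  - by move=> n; exact: mug_measurable_itv.
  - by apply: bigcup_measurable => n _; exact: mug_measurable_itv.
  - move=> m n mn; apply/subsetPset => y /=; rewrite !in_itv/=.
    move=> /andP[-> /= /le_trans]; apply.
    rewrite /r lerD2l lerN2 ler_pM2l ?subr_gt0//.
    by rewrite lef_pV2 ?posrE// ler_nat ltnS.
have c2 : (mug \o (fun n => `]x, r n]%classic : set R)) n @[n --> \oo] -->
          (gclamp t - gplus x)%:E.
  have -> : mug \o (fun n => `]x, r n]%classic : set R) =
            (fun n => (gplus (r n) - gplus x)%:E).
    by apply/funext => n /=; rewrite mug_oc.
  apply: cvg_EFin; first exact: nearW.
  rewrite [X in X @ _ --> _](_ : _ = fun n => gplus (r n) - gplus x)//.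
  apply: cvgB; last exact: cvg_cst.
  apply: (@squeeze_cvgr _ _ _ _ (gclamp \o r) (cst (gclamp t))).
  - apply: nearW => n /=.
    by rewrite gclamp_le_gplus gplus_le_gclamp.
  - exact: cvg_comp rcvgl (gclamp_left tb).
  - exact: cvg_cst.
exact: (cvg_unique _ c1 c2).
Qed.

Lemma mug_itv s t : a <= s -> s <= t -> t <= b ->
  mug `[s, t[%classic = (g t - g s)%:E.
Proof.
move=> as_ st tb.
have gE x : a <= x -> x <= b -> gclamp x = g x.
  move=> ax xb; rewrite /gclamp (min_idPl _)//.
  by rewrite (max_idPr _).
have s1 : s - 1 < s by rewrite ltrBlDr ltrDl.
have UE : `]s - 1, t[%classic = (`]s - 1, s[ `|` `[s, t[)%classic :> set R.
  apply/seteqP; split => x /=; rewrite !in_itv/=.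
    move=> /andP[-> ->]; rewrite andbT/=.
    by case: (ltP x s); [left|right].
  move=> [/andP[-> /lt_le_trans]|/andP[sx ->]]; first exact.
  by rewrite (lt_le_trans s1).
have := mug_oo (lt_le_trans s1 st) tb.
rewrite UE measureU; last 3 first.
- exact: mug_measurable_itv.
- exact: mug_measurable_itv.
- apply/seteqP; split => x //= []; rewrite !in_itv/=.
  by move=> /andP[_ xs] /andP[/le_lt_trans /(_ xs)]; rewrite ltxx.
move=> H; have {H} : (mug `](s - 1)%R, s[%classic + mug `[s, t[%classic =
  (gclamp t - gplus (s - 1))%R%:E)%E := H.
rewrite mug_oo ?(le_trans st)// !gE ?(le_trans as_)// ?(le_trans st)//.
case: (mug _) => [r| |]//=; rewrite -EFinD => -[H]; congr EFin.
by apply: (addrI (g s - gplus (s - 1))); rewrite H [RHS]addrC subrKA.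
Qed.

End stieltjes_measure.

(* Selects the scalar field of the test functions. Scalars are encoded in
   R[i], the real ones having zero imaginary part. *)
Variant base_field := RealField | ComplexField.

Definition scalars (R : realType) (K : base_field) : set R[i] :=
  if K is RealField then [set z | complex.Im z = 0] else setT.

Section stieltjes_spaces.
Context (R : realType) (a b : R) (g : derivator a b).
Local Open Scope complex_scope.

Definition L_g (p : \bar R) (v : R -> R) : Prop :=
  (v \_ `[a, b[) \in Lfun (mug g) p.

Definition L_gC (p : \bar R) (v : R -> R[i]) : Prop :=
  L_g p (fun t => complex.Re (v t)) /\ L_g p (fun t => complex.Im (v t)).

Definition L_gV d (p : \bar R) (v : R -> 'rV[R]_d) : Prop :=
  forall i, L_g p (fun t => v t 0 i).

Definition int_g (D : set R) (v : R -> R) : R := \int[mug g]_(s in D) v s.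

Definition int_gC (D : set R) (v : R -> R[i]) : R[i] :=
  int_g D (fun s => complex.Re (v s)) +i* int_g D (fun s => complex.Im (v s)).

Definition int_gV d (D : set R) (v : R -> 'rV[R]_d) : 'rV[R]_d :=
  \row_i int_g D (fun s => v s 0 i).

Definition AC_g (u : R -> R) : Prop :=
  forall e : R, 0 < e -> exists2 r : R, 0 < r &
    forall (n : nat) (s t : 'I_n -> R),
      (forall j, a <= s j /\ s j < t j /\ t j <= b) ->
      (forall i j, i != j -> `[s i, t i[ `&` `[s j, t j[ = set0) ->
      \sum_(j < n) (g (t j) - g (s j)) < r ->
      \sum_(j < n) `|u (t j) - u (s j)| < e.

Definition AC_gV d (u : R -> 'rV[R]_d) : Prop :=
  forall i, AC_g (fun t => u t 0 i).

(* v is a representative of the Stieltjes derivative of u. *)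
Definition is_D_g (u v : R -> R[i]) : Prop :=
  L_gC 1 v /\ forall t, a <= t <= b -> u t = u a + int_gC `[a, t[ v.

Definition rlim (f : R -> R) (t : R) : R := lim (f x @[x --> t^'+]).

Definition J_g : set R := [set t | a <= t < b /\ 0 < rlim g t - g t].

Definition S_g (phi : R -> R[i]) (t : R) : R[i] :=
  if `[< J_g t >] then
    rlim (fun s => complex.Re (phi s)) t +i* rlim (fun s => complex.Im (phi s)) t
  else phi t.

Definition T_g (K : base_field) (phi : R -> R[i]) : Prop :=
  exists (c : R[i]) (psi : R -> R[i]),
    [/\ scalars K c, (forall t, a <= t < b -> scalars K (psi t)),
        L_gC +oo psi &
        forall t, a <= t <= b -> phi t = c + int_gC `[a, t[ psi].

Definition integral_solution d (F : R -> 'rV[R]_d -> 'rV[R]_d)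
    (u0 : 'rV[R]_d) (U : R -> 'rV[R]_d) : Prop :=
  [/\ AC_gV U, L_gV 1 (fun s => F s (U s)) &
      forall t, a <= t <= b -> U t = u0 + int_gV `[a, t[ (fun s => F s (U s))].

Definition weak_solution (K : base_field) d (F : R -> 'rV[R]_d -> 'rV[R]_d)
    (u : R -> 'rV[R]_d) (u0 ub : 'rV[R]_d) : Prop :=
  [/\ L_gV 1 u, L_gV 1 (fun s => F s (u s)) &
      forall phi, T_g K phi -> forall psi, is_D_g phi psi -> forall i,
        int_gC `[a, b[ (fun s => (u s 0 i)%:C * psi s) +
        int_gC `[a, b[ (fun s => (F s (u s) 0 i)%:C * S_g phi s) =
        (ub 0 i)%:C * phi b - (u0 0 i)%:C * phi a].

End stieltjes_spaces.

Definition enorm (R : realType) d (x : 'rV[R]_d) : R :=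
  Num.sqrt (\sum_i x 0 i ^+ 2).

(* Main.v *)
(* Everything reduces to primitives P f t := int_[tau < t] f of integrable
   functions. Fubini on T x T, cut along tau y <= tau x and tau x < tau y, gives
     P f * P h = P (f * (P^+ h)(tau)) + P (h * (P f)(tau)),
   where P^+ h t := int_[tau <= t] h takes the jump at t into account.
   Applied to E_0 := 1, E_(k+1) := P (L * E_k(tau)), this product rule yields
   E_k <= (int L)^k / k!, whence a Gronwall lemma (uniqueness) and the uniform
   convergence of the Picard iterates (existence).
   Since S_g phi = phi a + P^+ psi for phi = phi a + P psi, the product rule is
   also the weak identity for primitives. Conversely, if v is a weak solution,
   W := u0 + P F(., v) satisfies the same weak identity; subtracting, and
   testing with phi = 1 and then with psi = sign (v - W), gives v = W almost
   everywhere, so W is an integral solution. *)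
Require Import Defs.
From mathcomp Require Import all_boot all_order all_algebra.
From mathcomp Require Import all_classical all_reals all_analysis.
From mathcomp Require Import measurable_realfun ess_sup_inf complex ring.
Set Implicit Arguments.
Unset Strict Implicit.
Unset Printing Implicit Defensive.
Import Order.TTheory GRing.Theory Num.Theory.
Import numFieldNormedType.Exports.
Local Open Scope classical_set_scope.
Local Open Scope ring_scope.

(** * Primitives and the product rule *)

Section real_integrable.
Context {d : measure_display} {T : measurableType d} {R : realType}
  (mu : {measure set T -> \bar R}).
Implicit Types f h : T -> R.
Local Notation integrableT f := (mu.-integrable setT (EFin \o f)).

Lemma integrable_sub (D : set T) f : measurable D -> integrableT f ->
  mu.-integrable D (EFin \o f).
Proof. by move=> mD; apply: integrableS. Qed.

Lemma EFin_Rintegral (D : set T) f : measurable D -> integrableT f ->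
  (\int[mu]_(x in D) f x)%:E = (\int[mu]_(x in D) (f x)%:E)%E.
Proof.
by move=> mD fi; rewrite fineK//; exact/integrable_fin_num/integrable_sub.
Qed.

Lemma integrable_meas f : integrableT f -> measurable_fun setT f.
Proof. by move/measurable_int/measurable_EFinP. Qed.

Lemma integrable_patch (D : set T) f : measurable D -> integrableT f ->
  integrableT (f \_ D).
Proof.
move=> mD fi; rewrite -restrict_EFin.
by apply/(integrable_mkcond _ mD).1/integrable_sub.
Qed.

Lemma ge0_Rintegral_subset (D E : set T) f : measurable D -> measurable E ->
  D `<=` E -> integrableT f -> (forall x, 0 <= f x) ->
  \int[mu]_(x in D) f x <= \int[mu]_(x in E) f x.
Proof.
move=> mD mE DE fi f0; rewrite /Rintegral fine_le//.
- exact/integrable_fin_num/integrable_sub.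
- exact/integrable_fin_num/integrable_sub.
- apply: ge0_subset_integral => //.
    exact/measurable_EFinP/(measurable_funS measurableT)/integrable_meas.
  by move=> x _; rewrite lee_fin.
Qed.

Lemma integrable_mul_bounded f h (M : R) : integrableT f ->
  measurable_fun setT h -> (forall x, `|h x| <= M) ->
  integrableT (fun x => f x * h x).
Proof.
move=> fi mh hM; have M0 : 0 <= `|M| by [].
have : mu.-integrable setT (fun x => (`|M|)%:E * (f x)%:E)%E.
  exact: (integrableZl measurableT `|M| fi).
apply: le_integrable => //.
  by apply/measurable_EFinP; apply: measurable_funM => //; exact: integrable_meas.
move=> x _ /=; rewrite lee_fin !normrM mulrC ler_wpM2r// normr_id.
by rewrite (le_trans (hM x))// ler_norm.
Qed.

Lemma integrable_add (f h : T -> R) : integrableT f -> integrableT h ->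
  integrableT (fun x => f x + h x).
Proof. by move=> fi hi; exact: (integrableD measurableT fi hi). Qed.

Lemma integrable_scale (c : R) (f : T -> R) : integrableT f ->
  integrableT (fun x => c * f x).
Proof. exact: (integrableZl measurableT c). Qed.

(** The sign of [f], set to 1 at its zeros, is the test derivative that later turns an integral of
    [f] into one of its absolute value. *)
Lemma measurable_sign f : measurable_fun setT f ->
  measurable_fun setT (fun x => if 0 <= f x then 1 else -1 : R).
Proof. by move=> mf; apply: measurable_fun_ifT => //; exact: measurable_fun_ler. Qed.

Lemma Rintegral_bigsetU_ord n (I : 'I_n -> set T) f :
  (forall j, measurable (I j)) -> trivIset setT I -> integrableT f ->
  \int[mu]_(x in \big[setU/set0]_j I j) f x = \sum_j \int[mu]_(x in I j) f x.
Proof.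
move=> mI tI fi; have mU : measurable (\big[setU/set0]_j I j).
  exact: bigsetU_measurable.
apply: EFin_inj; rewrite EFin_Rintegral// integral_bigsetU_EFin//.
- by rewrite -sumEFin; apply: eq_bigr => j _; rewrite EFin_Rintegral.
- exact: index_enum_uniq.
- exact: sub_trivIset tI.
- apply: (measurable_funS measurableT) => //.
  exact: (measurable_int mu fi).
Qed.

End real_integrable.

(** * Strict and large primitives along a time map, and their product rule *)

Section primitive.
Context {d : measure_display} {T : measurableType d} {R : realType}
  (mu : {sigma_finite_measure set T -> \bar R}) (tau : T -> R).
Hypothesis mtau : measurable_fun setT tau.

Implicit Types f h : T -> R.
Local Notation integrableT f := (mu.-integrable setT (EFin \o f)).

(** The map [tau] reads off the time of a point of [T]. Keeping [T] apart from the time line lets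
    [T] carry a completed sigma-algebra while [prim f] is Borel measurable on [R]. *)
Definition prim (f : T -> R) (t : R) : R :=
  \int[mu]_(x in [set x | tau x < t]) f x.

Definition primc (f : T -> R) (t : R) : R :=
  \int[mu]_(x in [set x | tau x <= t]) f x.

Lemma prim_def f t : prim f t = \int[mu]_(x in [set x | tau x < t]) f x.
Proof. by []. Qed.

Lemma primc_def f t : primc f t = \int[mu]_(x in [set x | tau x <= t]) f x.
Proof. by []. Qed.

Lemma measurable_tau_lt t : measurable [set x | tau x < t].
Proof.
rewrite -[X in measurable X]setTI (_ : [set x | tau x < t] = tau @^-1` `]-oo, t[).
  by apply: mtau => //; exact: measurable_itv.
by apply/seteqP; split=> x /=; rewrite in_itv.
Qed.

Lemma measurable_tau_le t : measurable [set x | tau x <= t].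
Proof.
rewrite -[X in measurable X]setTI (_ : [set x | tau x <= t] = tau @^-1` `]-oo, t]).
  by apply: mtau => //; exact: measurable_itv.
by apply/seteqP; split=> x /=; rewrite in_itv.
Qed.

Local Hint Resolve measurable_tau_lt measurable_tau_le : core.

Lemma prim_ge0 f t : (forall x, 0 <= f x) -> 0 <= prim f t.
Proof. by move=> f0; apply: Rintegral_ge0. Qed.

Lemma prim_mono f : integrableT f -> (forall x, 0 <= f x) ->
  {homo prim f : s t / s <= t}.
Proof.
move=> fi f0 s t st; apply: ge0_Rintegral_subset => // x /= /lt_le_trans; exact.
Qed.

Lemma primc_mono f : integrableT f -> (forall x, 0 <= f x) ->
  {homo primc f : s t / s <= t}.
Proof.
move=> fi f0 s t st; apply: ge0_Rintegral_subset => // x /= /le_trans; exact.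
Qed.

Lemma prim_le_primc f t : integrableT f -> (forall x, 0 <= f x) ->
  prim f t <= primc f t.
Proof. by move=> fi f0; apply: ge0_Rintegral_subset => // x /= /ltW. Qed.

Lemma prim_le_total f t : integrableT f -> (forall x, 0 <= f x) ->
  prim f t <= \int[mu]_x f x.
Proof. by move=> fi f0; apply: ge0_Rintegral_subset. Qed.

Lemma prim_le f h t : integrableT f -> integrableT h ->
  (forall x, tau x < t -> f x <= h x) -> prim f t <= prim h t.
Proof. by move=> fi hi fh; apply: le_Rintegral => //; exact: integrable_sub. Qed.

Lemma eq_prim f h t : (forall x, tau x < t -> f x = h x) -> prim f t = prim h t.
Proof. by move=> fh; apply: eq_Rintegral => x /set_mem; apply: fh. Qed.

Lemma primD f h t : integrableT f -> integrableT h ->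
  prim (fun x => f x + h x) t = prim f t + prim h t.
Proof. by move=> fi hi; apply: RintegralD => //; exact: integrable_sub. Qed.

Lemma primB f h t : integrableT f -> integrableT h ->
  prim (fun x => f x - h x) t = prim f t - prim h t.
Proof. by move=> fi hi; apply: RintegralB => //; exact: integrable_sub. Qed.

Lemma primZ c f t : integrableT f -> prim (fun x => c * f x) t = c * prim f t.
Proof. by move=> fi; apply: RintegralZl => //; exact: integrable_sub. Qed.

Lemma primcB f h t : integrableT f -> integrableT h ->
  primc (fun x => f x - h x) t = primc f t - primc h t.
Proof. by move=> fi hi; apply: RintegralB => //; exact: integrable_sub. Qed.

Lemma norm_prim f t : integrableT f -> `|prim f t| <= prim (fun x => `|f x|) t.
Proof. by move=> fi; apply: le_normr_Rintegral => //; exact: integrable_sub. Qed.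

Lemma norm_prim_total f t : integrableT f ->
  `|prim f t| <= \int[mu]_x `|f x|.
Proof.
move=> fi; apply: le_trans (norm_prim _ fi) _.
by apply: prim_le_total => //; exact: integrable_norm.
Qed.

Lemma norm_primc_total f t : integrableT f ->
  `|primc f t| <= \int[mu]_x `|f x|.
Proof.
move=> fi; apply: (@le_trans _ _ (primc (fun x => `|f x|) t)).
  by apply: le_normr_Rintegral => //; exact: integrable_sub.
by apply: ge0_Rintegral_subset => //; exact: integrable_norm.
Qed.

Lemma integrable_pos f : integrableT f -> integrableT f^\+.
Proof. exact: integrable_funrpos. Qed.

Lemma integrable_neg f : integrableT f -> integrableT f^\-.
Proof. exact: integrable_funrneg. Qed.

(** The positive and negative parts of [f] have nondecreasing primitives, and monotone functions are
    Borel. *)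
Lemma measurable_prim f : integrableT f -> measurable_fun setT (prim f).
Proof.
move=> fi; have [pf nf] := (integrable_pos fi, integrable_neg fi).
rewrite (_ : prim f = fun t => prim f^\+ t - prim f^\- t).
  apply: measurable_funB; apply: nondecreasing_measurable => //;
    exact: prim_mono.
by apply/funext => t; rewrite -primB// -[in LHS](funrposBneg f).
Qed.

Lemma measurable_primc f : integrableT f -> measurable_fun setT (primc f).
Proof.
move=> fi; have [pf nf] := (integrable_pos fi, integrable_neg fi).
rewrite (_ : primc f = fun t => primc f^\+ t - primc f^\- t).
  apply: measurable_funB; apply: nondecreasing_measurable => //;
    exact: primc_mono.
by apply/funext => t; rewrite -primcB// -[in LHS](funrposBneg f).
Qed.

Lemma integrable_mul_prim f h : integrableT f -> integrableT h ->
  integrableT (fun x => f x * prim h (tau x)).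
Proof.
move=> fi hi; apply: (integrable_mul_bounded fi _ (fun x => norm_prim_total _ hi)).
by apply: measurableT_comp mtau; exact: measurable_prim.
Qed.

Lemma integrable_mul_primc f h : integrableT f -> integrableT h ->
  integrableT (fun x => f x * primc h (tau x)).
Proof.
move=> fi hi; apply: (integrable_mul_bounded fi _ (fun x => norm_primc_total _ hi)).
by apply: measurableT_comp mtau; exact: measurable_primc.
Qed.

(* Fubini on the two halves tau y <= tau x and tau x < tau y of T x T. *)
Lemma Rintegral_mul_split f h : integrableT f -> integrableT h ->
  (\int[mu]_x f x) * (\int[mu]_x h x) =
  \int[mu]_x (f x * primc h (tau x)) + \int[mu]_x (h x * prim f (tau x)).
Proof.
move=> fi hi; have [mf mh] := (integrable_meas fi, integrable_meas hi).
pose S := [set z : T * T | tau z.2 <= tau z.1].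
have mS : measurable S.
  rewrite -[X in measurable X]setTI.
  rewrite (_ : S = (fun z : T * T => tau z.2 <= tau z.1) @^-1` [set true]).
    apply: measurable_fun_ler => //; apply: measurableT_comp => //.
  by apply/seteqP; split.
pose p (z : T * T) : R := f z.1 * h z.2.
have mp : measurable_fun setT p.
  by apply: measurable_funM; apply: measurableT_comp.
have ip : (mu \x mu)%E.-integrable setT (EFin \o p).
  (* Integrability on the product reduces to a finite iterated integral of the absolute value, which
     factors. *)
  apply/integrable12ltyP; first exact/measurable_EFinP.
  under eq_integral => x _.
    rewrite (_ : (fun y => _) = (fun y => (`|f x|%:E * `|h y|%:E)%E)); last first.
      by apply/funext => y /=; rewrite normrM EFinM.
    rewrite (integralZl _ (integrable_norm hi))//.
    over.
  rewrite /=.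
  have hfin : (\int[mu]_x `|h x|%:E)%E \is a fin_num.
    exact: integrable_fin_num (integrable_norm hi).
  under eq_integral => x _ do rewrite -(fineK hfin).
  rewrite integralZr//; last exact: (integrable_norm fi).
  have ffin : (\int[mu]_x `|f x|%:E)%E \is a fin_num.
    exact: integrable_fin_num (integrable_norm fi).
  by rewrite fineK// -(fineK ffin) -(fineK hfin) -EFinM ltry.
have iS : (mu \x mu)%E.-integrable setT (EFin \o (p \_ S)).
  rewrite -restrict_EFin; apply: ((integrable_mkcond _ mS).1 _).
  exact: integrableS ip.
have mCS : measurable (~` S) by exact: measurableC.
have iCS : (mu \x mu)%E.-integrable setT (EFin \o (p \_ (~` S))).
  rewrite -restrict_EFin; apply: ((integrable_mkcond _ mCS).1 _).
  exact: integrableS ip.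
have E0 : (\int[mu \x mu]_z (p z)%:E = ((\int[mu]_x f x) * (\int[mu]_x h x))%:E)%E.
  rewrite -(integral12_prod_meas1 ip)/= /p/=.
  under eq_integral => x _.
    rewrite (_ : fubini_F _ _ _ = ((f x)%:E * (\int[mu]_y h y)%:E)%E); last first.
      by rewrite EFin_Rintegral// -integralZl.
    over.
  by rewrite /= integralZr// EFinM !EFin_Rintegral.
have E1 : (\int[mu \x mu]_z ((p \_ S) z)%:E =
           (\int[mu]_x (f x * primc h (tau x)))%:E)%E.
  rewrite -(integral12_prod_meas1 iS)/=.
  rewrite EFin_Rintegral//; last exact: integrable_mul_primc.
  apply: eq_integral => x _.
  rewrite EFinM EFin_Rintegral// -integralZl//; last exact: integrable_sub.
  rewrite [RHS]integral_mkcond; apply: eq_integral => y _.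
  rewrite /patch/= (_ : (y \in _) = ((x, y) \in S)); first by case: ifPn.
  by apply/idP/idP => /set_mem ?; exact/mem_set.
(* On the complement the integration in the first variable comes first: for fixed [y] the slice is
   [tau x < tau y], whence the strict primitive of [f]. *)
have E2 : (\int[mu \x mu]_z ((p \_ (~` S)) z)%:E =
           (\int[mu]_x (h x * prim f (tau x)))%:E)%E.
  rewrite -(integral21_prod_meas1 iCS)/=.
  rewrite EFin_Rintegral//; last exact: integrable_mul_prim.
  apply: eq_integral => y _.
  rewrite EFinM EFin_Rintegral// -integralZl//; last exact: integrable_sub.
  rewrite [RHS]integral_mkcond; apply: eq_integral => x _.
  rewrite /patch/= (_ : (x \in _) = ((x, y) \in ~` S)).
    by case: ifPn => //=; rewrite /p/= mulrC.
  apply/idP/idP => /set_mem/= yx; apply/mem_set => /=.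
    by apply/negP; rewrite -ltNge.
  by rewrite ltNge; exact/negP.
apply: EFin_inj; rewrite EFinD -E0 -E1 -E2.
rewrite -integralD_EFin//; apply: eq_integral => z _; rewrite /= /patch in_setC.
by congr EFin; case: (z \in S); rewrite ?addr0 ?add0r.
Qed.

(** This is [Rintegral_mul_split] for [f] and [h] cut to [tau x < t]: at such an [x] the inner
    integrals only see times up to [tau x], where the cut changes nothing. *)
Lemma prim_mul_prim f h t : integrableT f -> integrableT h ->
  prim f t * prim h t = prim (fun x => f x * primc h (tau x)) t +
                        prim (fun x => h x * prim f (tau x)) t.
Proof.
move=> fi hi; have mt := measurable_tau_lt t.
rewrite /prim [in LHS]Rintegral_mkcond [X in _ * X]Rintegral_mkcond.
rewrite (Rintegral_mul_split (integrable_patch mt fi) (integrable_patch mt hi)).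
rewrite [in RHS]Rintegral_mkcond [X in _ = _ + X]Rintegral_mkcond.
congr (_ + _); apply: eq_Rintegral => x _;
  rewrite /patch; case: ifPn => [/set_mem/= xt|_]; rewrite ?mul0r//;
  congr (_ * _); apply: eq_Rintegral => y /set_mem/= yx; rewrite mem_set//=.
  exact: le_lt_trans yx xt.
exact: lt_trans yx xt.
Qed.

End primitive.

(** * Gronwall's lemma *)

Section gronwall.
Context {d : measure_display} {T : measurableType d} {R : realType}
  (mu : {sigma_finite_measure set T -> \bar R}) (tau : T -> R).
Hypothesis mtau : measurable_fun setT tau.
Implicit Types f h : T -> R.
Local Notation integrableT f := (mu.-integrable setT (EFin \o f)).
Local Notation prim := (prim mu tau).
Variable L : T -> R.
Hypotheses (Li : integrableT L) (L0 : forall x, 0 <= L x).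

(** These are the terms of the Peano-Baker series of the linear equation with coefficient [L] and
    initial value 1. *)
Fixpoint iter_prim (n : nat) (t : R) : R :=
  if n is n'.+1 then prim (fun x => L x * iter_prim n' (tau x)) t else 1.

Local Notation Lam := (\int[mu]_x L x).

Let Lam0 : 0 <= Lam. Proof. exact: Rintegral_ge0. Qed.

Lemma iter_prim_ge0 n t : 0 <= iter_prim n t.
Proof.
by elim: n t => [|n IH] t //=; apply: prim_ge0 => x; rewrite mulr_ge0.
Qed.

(** Measurability and the crude bound go through one induction, because the integrand of the next
    iterate is integrable only thanks to both. *)
Lemma iter_prim_meas_bound n :
  measurable_fun setT (iter_prim n) /\ forall t, iter_prim n t <= Lam ^+ n.
Proof.
elim: n => [|n [mE bE]] /=; first by split => // t; rewrite expr0.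
have iE : integrableT (fun x => L x * iter_prim n (tau x)).
  apply: (@integrable_mul_bounded _ _ _ mu _ _ (Lam ^+ n)) => //.
    exact: measurableT_comp mtau.
  by move=> x; rewrite ger0_norm// iter_prim_ge0.
split; first exact: measurable_prim.
move=> t; rewrite exprSr; apply: (@le_trans _ _ (prim (fun x => Lam ^+ n * L x) t)).
  apply: prim_le => //; first exact: (integrableZl measurableT (Lam ^+ n) Li).
  by move=> x _; rewrite mulrC ler_wpM2r.
by rewrite primZ// ler_wpM2l ?exprn_ge0// prim_le_total.
Qed.

Lemma integrable_mul_iter_prim n :
  integrableT (fun x => L x * iter_prim n (tau x)).
Proof.
have [mE bE] := iter_prim_meas_bound n.
apply: (@integrable_mul_bounded _ _ _ mu _ _ (Lam ^+ n)) => //.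
  exact: measurableT_comp mtau.
by move=> x; rewrite ger0_norm// iter_prim_ge0.
Qed.

(** The product rule expands [prim L * iter_prim n.+1] into two terms. In one of them the induction
    hypothesis yields [n.+1] copies of [iter_prim n.+2]; the other yields one more copy after
    [primc] is lowered to [prim], which drops the contribution of atoms. *)
Lemma iter_primS_le n t :
  n.+1%:R * iter_prim n.+1 t <= prim L t * iter_prim n t.
Proof.
elim: n t => [|n IH] t.
  by rewrite mul1r mulr1 /=; under eq_prim do rewrite mulr1.
set h := fun x => L x * iter_prim n (tau x).
have hi : integrableT h by exact: integrable_mul_iter_prim.
have h0 x : 0 <= h x by rewrite mulr_ge0// iter_prim_ge0.
rewrite prim_mul_prim// -natr1 mulrDl mul1r [leRHS]addrC.
have iE := integrable_mul_iter_prim n.+1.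
apply: lerD; rewrite [iter_prim n.+2 t]/=.
  rewrite -primZ//; apply: prim_le => //.
  - exact: (integrableZl measurableT _ iE).
  - exact: integrable_mul_prim.
  move=> x _; rewrite mulrCA (le_trans (ler_wpM2l (L0 x) (IH _)))//.
  by rewrite /h -mulrA ler_wpM2l// mulrC.
apply: prim_le => //; first exact: integrable_mul_primc.
by move=> x _; rewrite ler_wpM2l// prim_le_primc.
Qed.

Lemma iter_prim_le_fact n t : iter_prim n t <= exp_coeff Lam n.
Proof.
rewrite /exp_coeff/=; elim: n => [|n IH]; first by rewrite expr0 fact0 divr1.
have n0 : 0 < n.+1%:R :> R by rewrite ltr0n.
rewrite -(ler_pM2l n0) (le_trans (iter_primS_le n t))//.
rewrite factS natrM invfM mulrCA mulVKf ?gt_eqF// exprS -mulrA.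
by rewrite ler_pM ?iter_prim_ge0 ?prim_ge0 ?prim_le_total.
Qed.

Lemma iter_prim_cvg0 t : iter_prim n t @[n --> \oo] --> (0 : R).
Proof.
apply: (@squeeze_cvgr _ _ _ _ (cst 0) (exp_coeff Lam)).
- by apply: nearW => n; rewrite iter_prim_ge0 iter_prim_le_fact.
- exact: cvg_cst.
- exact/cvg_series_cvg_0/is_cvg_series_exp_coeff.
Qed.

(** Feeding the inequality into itself [n] times bounds [w] by [M * iter_prim n], which tends to
    0. *)
Lemma gronwall (w : R -> R) (M : R) : measurable_fun setT w ->
  (forall t, 0 <= w t <= M) ->
  (forall t, w t <= prim (fun x => L x * w (tau x)) t) -> forall t, w t <= 0.
Proof.
move=> mw w0M wle t.
have M0 : 0 <= M by have /andP[w0 /(le_trans w0)] := w0M 0.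
have iw : integrableT (fun x => L x * w (tau x)).
  apply: (@integrable_mul_bounded _ _ _ mu _ _ M) => //.
    exact: measurableT_comp mtau.
  by move=> x; have /andP[w0 wM] := w0M (tau x); rewrite ger0_norm.
have wE n s : w s <= M * iter_prim n s.
  elim: n s => [|n IH] s /=; first by rewrite mulr1; case/andP: (w0M s).
  rewrite (le_trans (wle s))// -primZ//; last exact: integrable_mul_iter_prim.
  apply: prim_le => //.
    exact: (integrableZl measurableT _ (integrable_mul_iter_prim n)).
  by move=> x _; rewrite mulrCA ler_wpM2l.
have: M * iter_prim n t @[n --> \oo] --> M * 0.
  by apply: cvgM; [exact: cvg_cst|exact: iter_prim_cvg0].
rewrite mulr0 => c; apply: (cvgr_to_ge c); exact: nearW.
Qed.

End gronwall.

(** * Picard iteration for Caratheodory equations *)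

(** A sum of absolute values commutes with integration, so the norm of a vector primitive is
    controlled coordinate by coordinate. The Euclidean norm of the hypotheses is compared with it at
    the end. *)
Definition l1norm (R : realType) n (v : 'rV[R]_n) : R := \sum_i `|v 0 i|.

Section l1norm.
Context (R : realType) (n : nat).
Implicit Types v w : 'rV[R]_n.

Lemma l1norm_ge0 v : 0 <= l1norm v.
Proof. by apply: sumr_ge0. Qed.

Lemma l1norm_coord v i : `|v 0 i| <= l1norm v.
Proof. by rewrite /l1norm (bigD1 i)//= lerDl sumr_ge0. Qed.

Lemma l1normD v w : l1norm (v + w) <= l1norm v + l1norm w.
Proof.
by rewrite /l1norm -big_split/=; apply: ler_sum => i _; rewrite mxE ler_normD.
Qed.

Lemma l1normN v : l1norm (- v) = l1norm v.
Proof. by apply: eq_bigr => i _; rewrite mxE normrN. Qed.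

Lemma l1norm0 : l1norm (0 : 'rV[R]_n) = 0.
Proof. by apply: big1 => i _; rewrite mxE normr0. Qed.

Lemma l1norm_le v (M : R) : (forall i, `|v 0 i| <= M) -> l1norm v <= n%:R * M.
Proof.
move=> vM; apply: (@le_trans _ _ (\sum_(i < n) M)); first exact: ler_sum.
by rewrite sumr_const card_ord mulr_natl.
Qed.

Lemma l1norm_sub_eq0 v w : l1norm (v - w) <= 0 -> v = w.
Proof.
move=> vw; apply/rowP => i; apply/eqP; rewrite -subr_eq0 -normr_le0.
by apply: le_trans vw; have := l1norm_coord (v - w) i; rewrite !mxE.
Qed.

Lemma measurable_l1norm d (T : measurableType d) (Y : T -> 'rV[R]_n) :
  (forall i, measurable_fun setT (fun x => Y x 0 i)) ->
  measurable_fun setT (fun x => l1norm (Y x)).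
Proof.
move=> mY; rewrite /l1norm; apply: (@measurable_sum _ _ _ setT) => i.
exact: measurableT_comp.
Qed.

End l1norm.

(* Discretizing Y by floors leaves countably many values, on each of which
   the composition is measurable by hypothesis. *)
Lemma measurable_lipschitz_comp d (T : measurableType d) (R : realType) n
    (G : T -> 'rV[R]_n -> R) (L : T -> R) (Y : T -> 'rV[R]_n) :
  (forall v, measurable_fun setT (G ^~ v)) ->
  (forall x v w, `|G x v - G x w| <= L x * l1norm (v - w)) ->
  (forall i, measurable_fun setT (fun x => Y x 0 i)) ->
  measurable_fun setT (fun x => G x (Y x)).
Proof.
move=> mG GL mY.
pose Z (k : nat) (x : T) : 'rV[int]_n := \row_i Num.floor (k.+1%:R * Y x 0 i).
pose val (k : nat) (z : 'rV[int]_n) : 'rV[R]_n := \row_i ((z 0 i)%:~R / k.+1%:R).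
apply: (@measurable_fun_cvg _ _ _ setT (fun k x => G x (val k (Z k x)))).
  move=> k _ B mB; rewrite setTI.
  rewrite (_ : _ @^-1` B = \bigcup_(z in [set: 'rV[int]_n])
      ((\bigcap_(i in [set: 'I_n])
        [set x | (z 0 i)%:~R <= k.+1%:R * Y x 0 i < (z 0 i + 1)%:~R]) `&`
       (G ^~ (val k z)) @^-1` B)); last first.
    apply/seteqP; split => x /=.
      move=> GB; exists (Z k x) => //; split => //= i _ /=.
      by rewrite mxE floor_itv.
    move=> [z _ [/= zx GB]]; rewrite (_ : Z k x = z)//; apply/rowP => i.
    by rewrite mxE; apply/eqP; rewrite floor_eq; exact: zx.
  apply: countable_bigcupT_measurable; first exact: countableP.
  move=> z; apply: measurableI; last by rewrite -[X in measurable X]setTI; exact: mG.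
  apply: fin_bigcap_measurable => // i _.
  rewrite -[X in measurable X]setTI.
  rewrite (_ : [set x | _] = (fun x => k.+1%:R * Y x 0 i) @^-1`
                `[(z 0 i)%:~R, (z 0 i + 1)%:~R[); last first.
    by apply/seteqP; split=> x /=; rewrite in_itv.
  by apply: measurable_funM => //; exact: measurable_itv.
move=> x _; apply/cvgrPdist_le => e e0.
(* Taking floors at scale [k.+1] moves each coordinate by at most [1 / k.+1]. *)
have Yk k : l1norm (Y x - val k (Z k x)) <= n%:R * k.+1%:R^-1.
  apply: l1norm_le => i; rewrite !mxE.
  have k0 : 0 < k.+1%:R :> R by rewrite ltr0n.
  rewrite -(ler_pM2l k0) mulfV ?gt_eqF// -{1}(gtr0_norm k0) -normrM mulrBr.
  rewrite mulrCA mulfV ?gt_eqF// mulr1.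
  have /andP[l u] := floor_itv (k.+1%:R * Y x 0 i).
  by rewrite ger0_norm ?subr_ge0// lerBlDl (le_trans (ltW u))// intrD.
have c : `|L x| * (n%:R * k.+1%:R^-1) @[k --> \oo] --> (0 : R).
  rewrite -(mulr0 `|L x|) -(mulr0 n%:R).
  by do 2 (apply: cvgM; first exact: cvg_cst); exact: cvg_harmonic.
near=> k.
apply: (@le_trans _ _ (`|L x| * (n%:R * k.+1%:R^-1))).
  apply: le_trans (GL _ _ _) _.
  by rewrite (le_trans (ler_wpM2r (l1norm_ge0 _) (ler_norm _)))// ler_wpM2l.
near: k; exact: cvgr_le c _ e0.
Unshelve. all: by end_near. Qed.

(** * The Picard operator: estimates, uniqueness and existence of its fixed point *)

Section picard.
Context {d : measure_display} {T : measurableType d} {R : realType}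
  (mu : {sigma_finite_measure set T -> \bar R}) (tau : T -> R).
Hypothesis mtau : measurable_fun setT tau.
Local Notation integrableT f := (mu.-integrable setT (EFin \o f)).
Local Notation prim := (prim mu tau).

Lemma prim_sum n (f : 'I_n -> T -> R) t : (forall i, integrableT (f i)) ->
  integrableT (fun x => \sum_i f i x) /\
  prim (fun x => \sum_i f i x) t = \sum_i prim (f i) t.
Proof.
elim: n f => [|n IH] f fi.
  have -> : (fun x => \sum_(i < 0) f i x) = cst 0.
    by apply/funext => x; rewrite big_ord0.
  split; first exact: integrable0.
  by rewrite big_ord0 prim_def /Rintegral/= integral0.
have -> : (fun x => \sum_i f i x) =
    (fun x => f ord0 x + \sum_(i < n) f (lift ord0 i) x).
  by apply/funext => x; rewrite big_ord_recl.
have [si sE] := IH (fun i => f (lift ord0 i)) (fun i => fi _).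
by split; [exact: integrable_add|rewrite primD// sE big_ord_recl].
Qed.

Variable n : nat.
Implicit Types (f h : T -> 'rV[R]_n) (X Y : R -> 'rV[R]_n).

Definition vprim f (t : R) : 'rV[R]_n := \row_i prim (fun x => f x 0 i) t.

Lemma l1norm_vprim f t : (forall i, integrableT (fun x => f x 0 i)) ->
  integrableT (fun x => l1norm (f x)) /\
  l1norm (vprim f t) <= prim (fun x => l1norm (f x)) t.
Proof.
move=> fi; have [si sE] := prim_sum t (fun i => integrable_norm (fi i)).
split => //; rewrite /l1norm sE; apply: ler_sum => i _.
by rewrite mxE norm_prim.
Qed.

Lemma vprimB f h t : (forall i, integrableT (fun x => f x 0 i)) ->
  (forall i, integrableT (fun x => h x 0 i)) ->
  vprim f t - vprim h t = vprim (fun x => f x - h x) t.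
Proof.
move=> fi hi; apply/rowP => i; rewrite !mxE -primB//.
by apply: eq_prim => x _; rewrite !mxE.
Qed.

(** The class where fixed points are sought. It is stable under [picard] and contains every constant
    plus a primitive, so uniqueness inside it covers all solutions. *)
Definition bounded_measurable X :=
  (forall i, measurable_fun setT (fun t => X t 0 i)) /\
  exists M : R, forall t, l1norm (X t) <= M.

Lemma vprim_bounded_measurable u0 f : (forall i, integrableT (fun x => f x 0 i)) ->
  bounded_measurable (fun t => u0 + vprim f t).
Proof.
move=> fi; split=> [i|].
  rewrite (_ : (fun t => _) = fun t => u0 0 i + prim (fun x => f x 0 i) t).
    by apply: measurable_funD => //; exact: measurable_prim.
  by apply/funext => t; rewrite !mxE.
exists (l1norm u0 + \int[mu]_x l1norm (f x)) => t.
have [si sE] := l1norm_vprim t fi.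
rewrite (le_trans (l1normD _ _))// lerD2l (le_trans sE)// prim_le_total//.
by move=> x; exact: l1norm_ge0.
Qed.

Variables (F : T -> 'rV[R]_n -> 'rV[R]_n) (m L : T -> R).
Hypotheses (mi : integrableT m) (Li : integrableT L) (L0 : forall x, 0 <= L x).
Hypothesis mF : forall v i, measurable_fun setT (fun x => F x v 0 i).
Hypothesis F0 : forall x, l1norm (F x 0) <= m x.
Hypothesis FL : forall x v w, l1norm (F x v - F x w) <= L x * l1norm (v - w).

Let FLi i x v w : `|F x v 0 i - F x w 0 i| <= L x * l1norm (v - w).
Proof.
apply: le_trans (FL x v w).
by have := l1norm_coord (F x v - F x w) i; rewrite !mxE.
Qed.

Lemma l1norm_rhs x v : l1norm (F x v) <= m x + L x * l1norm v.
Proof.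
rewrite -[F x v](subrK (F x 0)) addrC (le_trans (l1normD _ _))// lerD//.
by rewrite (le_trans (FL _ _ _))// subr0.
Qed.

Lemma measurable_rhs (Y : T -> 'rV[R]_n) i :
  (forall i, measurable_fun setT (fun x => Y x 0 i)) ->
  measurable_fun setT (fun x => F x (Y x) 0 i).
Proof. exact: measurable_lipschitz_comp (fun v => mF v i) (FLi i). Qed.

(** If [M] bounds [X], linear growth provides the integrable majorant [m + M * L]. *)
Lemma integrable_rhs X i : bounded_measurable X ->
  integrableT (fun x => F x (X (tau x)) 0 i).
Proof.
move=> [mX [M XM]].
have : integrableT (fun x => m x + M * L x).
  by apply: integrable_add => //; exact: integrable_scale.
apply: le_integrable => //.
  apply/measurable_EFinP/measurable_rhs => j.
  exact: (measurableT_comp (mX j) mtau).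
move=> x _ /=; rewrite lee_fin (le_trans (l1norm_coord _ i))//.
rewrite (le_trans (l1norm_rhs _ _))// (le_trans _ (ler_norm _))// lerD2l.
by rewrite mulrC ler_wpM2r.
Qed.

Variable u0 : 'rV[R]_n.

Definition picard X t := u0 + vprim (fun x => F x (X (tau x))) t.

Lemma picard_bounded_measurable X : bounded_measurable X ->
  bounded_measurable (picard X).
Proof.
by move=> bX; apply: vprim_bounded_measurable => i; exact: integrable_rhs.
Qed.

Let measurable_dist X Y : bounded_measurable X -> bounded_measurable Y ->
  measurable_fun setT (fun t => l1norm (X t - Y t)).
Proof.
move=> [mX _] [mY _]; apply: measurable_l1norm => i.
under eq_fun do rewrite !mxE; exact: measurable_funB.
Qed.

Let dist_bound X Y : bounded_measurable X -> bounded_measurable Y ->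
  exists M, forall t, l1norm (X t - Y t) <= M.
Proof.
move=> [_ [M XM]] [_ [N YN]]; exists (M + N) => t.
by rewrite (le_trans (l1normD _ _))// l1normN lerD.
Qed.

Lemma integrable_mul_dist X Y : bounded_measurable X -> bounded_measurable Y ->
  integrableT (fun x => L x * l1norm (X (tau x) - Y (tau x))).
Proof.
move=> bX bY; have [M XYM] := dist_bound bX bY.
apply: (@integrable_mul_bounded _ _ _ mu _
  (fun x => l1norm (X (tau x) - Y (tau x))) M) => //.
  exact: (measurableT_comp (measurable_dist bX bY) mtau).
by move=> x; rewrite ger0_norm// l1norm_ge0.
Qed.

Lemma picard_dist X Y t : bounded_measurable X -> bounded_measurable Y ->
  l1norm (picard X t - picard Y t) <=
  prim (fun x => L x * l1norm (X (tau x) - Y (tau x))) t.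
Proof.
move=> bX bY; have iX i := integrable_rhs i bX; have iY i := integrable_rhs i bY.
rewrite /picard opprD addrACA subrr add0r vprimB//.
have iXY i : integrableT (fun x => (F x (X (tau x)) - F x (Y (tau x))) 0 i).
  rewrite (_ : (fun x => _) =
    fun x => F x (X (tau x)) 0 i - F x (Y (tau x)) 0 i).
    exact: (integrableB measurableT (iX i) (iY i)).
  by apply/funext => x; rewrite !mxE.
have [si sE] := l1norm_vprim t iXY.
rewrite (le_trans sE)//; apply: prim_le => //; exact: integrable_mul_dist.
Qed.

(** By [picard_dist], the distance between two fixed points satisfies the hypothesis of
    [gronwall]. *)
Lemma picard_unique X Y : bounded_measurable X -> bounded_measurable Y ->
  X =1 picard X -> Y =1 picard Y -> X =1 Y.
Proof.
move=> bX bY XE YE t; apply: l1norm_sub_eq0.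
have [M XYM] := dist_bound bX bY.
apply: (gronwall mtau Li L0 (w := fun t => l1norm (X t - Y t)) (M := M)).
- exact: measurable_dist.
- by move=> s; rewrite l1norm_ge0 XYM.
- by move=> s; rewrite {1}XE {1}YE picard_dist.
Qed.

Lemma bounded_measurable_cst v : bounded_measurable (fun=> v).
Proof. by split => //; exists (l1norm v). Qed.

(* The iterates X_k satisfy |X_(k+1) - X_k| <= C Lam^k / k!, which is summable
   uniformly in t. *)
Lemma picard_exists : exists2 X, bounded_measurable X & X =1 picard X.
Proof.
pose Xs k := iter k picard (fun=> u0).
have bXs k : bounded_measurable (Xs k).
  elim: k => [|k IH]; first exact: bounded_measurable_cst.
  exact: picard_bounded_measurable.
pose Lam := \int[mu]_x L x.
have Lam0 : 0 <= Lam by exact: Rintegral_ge0.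
have [C C1] : exists C, forall t, l1norm (Xs 1 t - Xs 0 t) <= C.
  exact: dist_bound.
have C0 : 0 <= C by rewrite (le_trans (l1norm_ge0 _) (C1 0)).
(* [C] bounds the first increment; each application of [picard] then integrates the bound against
   [L], which is the recursion of [iter_prim]. *)
have Xs_iter k t : l1norm (Xs k.+1 t - Xs k t) <= C * iter_prim mu tau L k t.
  elim: k t => [|k IH] t; first by rewrite mulr1.
  rewrite (le_trans (picard_dist t (bXs k.+1) (bXs k)))//.
  have iE := integrable_mul_iter_prim mtau Li L0 k.
  rewrite -primZ//; apply: prim_le => //.
  - exact: integrable_mul_dist.
  - exact: integrable_scale.
  by move=> x _; rewrite mulrCA ler_wpM2l.
have Xs_step k t i : `|Xs k.+1 t 0 i - Xs k t 0 i| <= C * exp_coeff Lam k.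
  have := l1norm_coord (Xs k.+1 t - Xs k t) i; rewrite !mxE => /le_trans; apply.
  by rewrite (le_trans (Xs_iter k t))// ler_wpM2l// iter_prim_le_fact.
pose S := series (exp_coeff Lam).
have eS k : S k.+1 = S k + exp_coeff Lam k by rewrite /S /series/= big_nat_recr.
have e0 k : 0 <= exp_coeff Lam k by rewrite exp_coeff_ge0.
have Xs_dist k j t i : `|Xs (k + j)%N t 0 i - Xs k t 0 i| <= C * (S (k + j)%N - S k).
  elim: j => [|j IH]; first by rewrite addn0 !subrr normr0 mulr0.
  rewrite addnS eS -(subrKA (Xs (k + j)%N t 0 i)) (le_trans (ler_normD _ _))//.
  by rewrite addrAC mulrDr [leRHS]addrC lerD.
have Scvg : S k @[k --> \oo] --> expR Lam.
  exact: is_cvg_series_exp_coeff.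
have Sle k : S k <= expR Lam.
  apply: (nondecreasing_cvgn_le _ Scvg).
  by apply/nondecreasing_seqP => j; rewrite eS lerDl.
(* The tail of the exponential series bounds all later increments, uniformly in [t] and in the
   coordinate. *)
pose r k := C * (expR Lam - S k).
have rcvg : r k @[k --> \oo] --> (0 : R).
  rewrite -(mulr0 C) -(subrr (expR Lam)).
  by apply: cvgM; [exact: cvg_cst|apply: cvgB => //; exact: cvg_cst].
have Xs_r k j t i : `|Xs (k + j)%N t 0 i - Xs k t 0 i| <= r k.
  by rewrite (le_trans (Xs_dist k j t i))// ler_wpM2l// lerD2r.
have Xcvg t i : cvgn (fun k => Xs k t 0 i).
  apply/cauchy_cvgP/cauchy_exP => e ep.
  have [k _ /(_ k (leqnn k))/= rk] := cvgr_lt _ rcvg _ ep.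
  exists (Xs k t 0 i); exists k => // j /= kj.
  by rewrite /ball/= distrC -(subnKC kj) (le_lt_trans (Xs_r _ _ _ _)).
pose X t := \row_i limn (fun k => Xs k t 0 i).
have XsX t i : Xs k t 0 i @[k --> \oo] --> X t 0 i by rewrite mxE; exact: Xcvg.
have XXs k t i : `|X t 0 i - Xs k t 0 i| <= r k.
  have c : `|Xs j t 0 i - Xs k t 0 i| @[j --> \oo] --> `|X t 0 i - Xs k t 0 i|.
    by apply: cvg_norm; apply: cvgB; [exact: XsX|exact: cvg_cst].
  apply: (cvgr_to_le c); exists k => // j /= kj.
  by rewrite -(subnKC kj).
have bX : bounded_measurable X.
  split=> [i|].
    apply: (@measurable_fun_cvg _ _ _ setT (fun k t => Xs k t 0 i)) => // k.
    exact: (bXs k).1.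
  (* The iterate [Xs 0] is the constant [u0], and [r 0] bounds each coordinate of [X - u0]. *)
  exists (n%:R * r 0%N + l1norm u0) => t.
  rewrite -[X t](subrK u0) (le_trans (l1normD _ _))// lerD2r.
  apply: l1norm_le => i; rewrite !mxE -[limn _]/(limn _).
  by have := XXs 0%N t i; rewrite mxE.
exists X => // t; apply/rowP => i.
have XsS : Xs k.+1 t 0 i @[k --> \oo] --> X t 0 i.
  by rewrite (cvg_shiftS (fun k => Xs k t 0 i)).
(* The shifted iterates tend to [X]; they also tend to [picard X], because [picard] is Lipschitz
   with constant [Lam] for the uniform distance. *)
suff c : Xs k.+1 t 0 i @[k --> \oo] --> picard X t 0 i.
  exact: (cvg_unique _ XsS c).
apply/cvgrPdist_le => e e0'.
have c : Lam * (n%:R * r k) @[k --> \oo] --> (0 : R).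
  rewrite -(mulr0 Lam) -(mulr0 n%:R).
  by do 2 (apply: cvgM; first exact: cvg_cst).
near=> k.
apply: (@le_trans _ _ (Lam * (n%:R * r k))).
  have := l1norm_coord (picard X t - picard (Xs k) t) i.
  rewrite !mxE => /le_trans; apply.
  rewrite (le_trans (picard_dist t bX (bXs k)))//.
  apply: (@le_trans _ _ (prim (fun x => n%:R * r k * L x) t)).
    apply: prim_le => //.
    - exact: integrable_mul_dist.
    - exact: integrable_scale.
    move=> x _; rewrite mulrC ler_wpM2r//; apply: l1norm_le => j.
    by have := XXs k (tau x) j; rewrite !mxE.
  rewrite primZ// mulrC ler_wpM2r// ?prim_le_total//.
  by rewrite mulr_ge0// mulr_ge0// subr_ge0.
near: k; exact: cvgr_le c _ e0'.
Unshelve. all: by end_near. Qed.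

End picard.

(** * Null sets and right limits of primitives *)

Section complete_measure.
Context {d : measure_display} {T : measurableType d} {R : realType}
  (mu : {measure set T -> \bar R}).
Hypothesis mu_complete : measure_is_complete mu.
Variable N : set T.
Hypotheses (mN : measurable N) (N0 : mu N = 0).

(** A preimage under [f] differs from one under [h] only inside [N], and completeness makes every
    subset of [N] measurable. *)
Lemma measurable_eq_off_null (f h : T -> R) :
  (forall x, ~ N x -> f x = h x) -> measurable_fun setT h ->
  measurable_fun setT f.
Proof.
move=> fh mh _ B mB; rewrite setTI.
rewrite (_ : f @^-1` B = (h @^-1` B `\` N) `|` (f @^-1` B `&` N)).
  apply: measurableU.
    by apply: measurableD => //; rewrite -[X in measurable X]setTI; exact: mh.
  by apply: mu_complete; exists N; split => // x [].
apply/seteqP; split => x /=.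
  by move=> Bx; have [Nx|Nx] := pselect (N x); [right|left; rewrite -fh].
by move=> [[Bx Nx]|[]//]; rewrite fh.
Qed.

Lemma Rintegral_eq_off_null (D : set T) (f h : T -> R) : measurable D ->
  (forall x, ~ N x -> f x = h x) -> measurable_fun setT h ->
  \int[mu]_(x in D) f x = \int[mu]_(x in D) h x.
Proof.
move=> mD fh mh; congr fine; apply: ae_eq_integral => //.
- apply/measurable_EFinP/(measurable_funS measurableT) => //.
  exact: measurable_eq_off_null fh mh.
- by apply/measurable_EFinP/(measurable_funS measurableT).
exists N; split => // x /= /not_implyP[_ fhx]; apply: contrapT => Nx.
by apply: fhx; rewrite fh.
Qed.

Lemma integrable_eq_off_null (f h : T -> R) :
  (forall x, ~ N x -> f x = h x) -> mu.-integrable setT (EFin \o h) ->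
  mu.-integrable setT (EFin \o f).
Proof.
move=> fh hi; have mh := integrable_meas hi.
have mf := measurable_eq_off_null fh mh.
apply/(negligible_integrable mN measurableT _ N0); first exact/measurable_EFinP.
apply: (@eq_integrable _ _ _ _ _ _ (EFin \o h)).
- by apply: measurableD.
- by move=> x /set_mem[_ Nx] /=; rewrite fh.
by apply: integrableS hi => //; exact: measurableD.
Qed.

End complete_measure.

(** * Jumps and right limits of primitives *)

Section primitive_jump.
Context {d : measure_display} {T : measurableType d} {R : realType}
  (mu : {sigma_finite_measure set T -> \bar R}) (tau : T -> R).
Hypothesis mtau : measurable_fun setT tau.
Implicit Type f : T -> R.
Local Notation integrableT f := (mu.-integrable setT (EFin \o f)).
Local Notation prim := (prim mu tau).
Local Notation primc := (primc mu tau).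

Lemma measurable_tau_eq t : measurable [set x | tau x = t].
Proof. by rewrite -[X in measurable X]setTI; exact: (mtau _ (measurable_set1 t)). Qed.

Lemma primcE f t : integrableT f ->
  primc f t = prim f t + \int[mu]_(x in [set x | tau x = t]) f x.
Proof.
move=> fi; have UE : [set x | tau x <= t] =
    [set x | tau x < t] `|` [set x | tau x = t].
  apply/seteqP; split => x /=; rewrite le_eqVlt.
    by move=> /predU1P[|]; [right|left].
  by move=> [->|->]; rewrite ?orbT ?eqxx.
rewrite primc_def UE Rintegral_setU//.
- exact: measurable_tau_lt.
- exact: measurable_tau_eq.
- rewrite -UE; apply: integrable_sub fi; exact: measurable_tau_le.
by apply/disj_setPS => x /= [] /[swap] -> ; rewrite ltxx.
Qed.

(** Dominated convergence along sequences [u n] decreasing or not to [t] from strictly above: the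
    sets [tau x < u n] converge pointwise to [tau x <= t], and [f] in absolute value is a
    majorant. *)
Lemma prim_right_limit f t : integrableT f ->
  prim f s @[s --> t^'+] --> primc f t.
Proof.
move=> fi; have mf := integrable_meas fi.
apply/cvg_at_rightP => u [ut uc].
have pE s : prim f s = fine (\int[mu]_x ((f \_ [set x | tau x < s]) x)%:E).
  exact: Rintegral_mkcond.
have pcE : primc f t = fine (\int[mu]_x ((f \_ [set x | tau x <= t]) x)%:E).
  exact: Rintegral_mkcond.
have ilt s : integrableT (f \_ [set x | tau x < s]).
  by apply: integrable_patch => //; exact: measurable_tau_lt.
have ile s : integrableT (f \_ [set x | tau x <= s]).
  by apply: integrable_patch => //; exact: measurable_tau_le.
under eq_fun do rewrite pE.
rewrite pcE; apply: (@fine_cvg _ _ _ _ (fun n =>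
  \int[mu]_x ((f \_ [set x | tau x < u n]) x)%:E)%E).
rewrite fineK; last exact: (integrable_fin_num measurableT (ile t)).
have [|||||_ _ //] := (@dominated_convergence _ _ _ mu setT measurableT
  (fun n => EFin \o (f \_ [set x | tau x < u n]))
  (EFin \o (f \_ [set x | tau x <= t])) (EFin \o (fun x => `|f x|))).
- by move=> n; exact: measurable_int (ilt _).
- exact: measurable_int (ile _).
- apply: aeW => x _; apply: cvg_EFin; first exact: nearW.
  rewrite /= /patch; have [xt|tx] := leP (tau x) t.
    rewrite mem_set//; apply: cvg_near_cst; apply: nearW => n.
    by rewrite /= mem_set//=; exact: le_lt_trans xt (ut n).
  rewrite memNset/=; last by apply/negP; rewrite -ltNge.
  apply: cvg_near_cst; have : \forall n \near \oo, u n < tau x by apply: cvgr_lt uc _ tx.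
  apply: filterS => n unx /=; rewrite memNset//=.
  by apply/negP; rewrite -leNgt ltW.
- exact: integrable_norm.
apply: aeW => x n _ /=; rewrite lee_fin /patch.
by case: ifPn => // _; rewrite normr0.
Qed.

End primitive_jump.

(** * Primitives with respect to a derivator *)

Section stieltjes_primitive.
Context (R : realType) (a b : R) (g : derivator a b).

(* [mug g] with its sigma-finite structure exposed, as Fubini requires. *)
Definition mugsf : {sigma_finite_measure set (stieltjes_type g) -> \bar R} :=
  completed_lebesgue_stieltjes_measure (gplus g).

(* The identity, seen as a map from the completed measurable space to the
   Borel line. *)
Definition time (x : stieltjes_type g) : R := x.

Lemma measurable_time : measurable_fun setT time.
Proof.
by move=> _ B mB; rewrite setTI; exact: sub_caratheodory.
Qed.

Lemma mug_complete : measure_is_complete (mug g).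
Proof. exact: measure_is_complete_caratheodory. Qed.

Lemma measurable_itv_stieltjes (i : interval R) :
  measurable ([set` i] : set (stieltjes_type g)).
Proof. apply: sub_caratheodory; exact: measurable_itv. Qed.

Local Notation D := (`[a, b[%classic : set R).
Local Notation integrableT f := (mugsf.-integrable setT (EFin \o f)).
Local Notation prim := (prim mugsf time).
Local Notation primc := (primc mugsf time).

Lemma L_g1P v : L_g g 1 v <-> integrableT (v \_ D).
Proof. exact: Lfun1_integrable. Qed.

(** Cutting [v] to [[a, b[] once and for all turns each integral over [[a, t[] into a primitive
    taken from minus infinity. *)
Lemma int_gE v t : t <= b -> int_g g `[a, t[ v = prim (v \_ D) t.
Proof.
move=> tb; rewrite /int_g Rintegral_mkcond [RHS]Rintegral_mkcond.
apply: eq_Rintegral => x _; rewrite /patch; case: ifPn => [/set_mem|/negP nx].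
  rewrite /= in_itv/= => /andP[ax xt]; rewrite !mem_set//=.
  by rewrite in_itv/= ax (lt_le_trans xt tb).
case: ifPn => [/set_mem/= xt|//]; case: ifPn => [/set_mem|//].
rewrite /= in_itv/= => /andP[ax _]; exfalso; apply: nx; apply/mem_set.
by rewrite /= in_itv/= ax.
Qed.

Lemma int_g_total v : int_g g D v = \int[mugsf]_x (v \_ D) x.
Proof. exact: Rintegral_mkcond. Qed.

Lemma prim_total f : (forall x, ~ D x -> f x = 0) ->
  prim f b = \int[mugsf]_x f x.
Proof.
move=> f0; rewrite [LHS]Rintegral_mkcond; apply: eq_Rintegral => x _.
rewrite /patch; case: ifPn => // /negP xb; rewrite f0//= in_itv/=.
by move=> /andP[_ xlt]; apply: xb; exact/mem_set.
Qed.

Hypothesis ab : a <= b.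

(** The cut constant 1 is integrable as [[a, b[] has finite mass. It serves to recover [g] as a
    primitive and to make bounded measurable functions integrable. *)
Lemma integrable_one : integrableT (cst (1 : R) \_ D).
Proof.
rewrite -restrict_EFin; apply: ((integrable_mkcond _ _).1 _).
  exact: measurable_itv_stieltjes.
apply: measurable_bounded_integrable.
- exact: measurable_itv_stieltjes.
- by rewrite mug_itv// ltry.
- exact: measurable_cst.
by exists 1; split => // M M1 x _ /=; rewrite normr1 ltW.
Qed.

(** With [g] itself written as a primitive, its right limits and jumps follow from the general
    results. *)
Lemma prim_one t : a <= t <= b -> g t = g a + prim (cst (1 : R) \_ D) t.
Proof.
move=> /andP[at_ tb]; rewrite -int_gE// /int_g.
rewrite (@Rintegral_cst _ _ _ (mug g)) ?mug_itv//.
  by rewrite mul1r/= addrC subrK.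
exact: measurable_itv_stieltjes.
Qed.

(** Absolute continuity of the integral gives [r]. It applies to the union of the intervals, whose
    mass is the sum of the increments of [g] by disjointness. *)
Lemma AC_g_primitive (u : R -> R) c p : integrableT p ->
  (forall t, a <= t <= b -> u t = c + prim p t) -> AC_g g u.
Proof.
move=> pi uE e e0.
have [r [r0 rP]] := integral_normr_continuous pi e0.
exists r => // n s t st disj sr.
pose I j : set (stieltjes_type g) := `[s j, t j[%classic.
have mI j : measurable (I j) by exact: measurable_itv_stieltjes.
have tI : trivIset setT I.
  apply/trivIsetP => i j _ _ ij; exact: disj.
have mU : measurable (\big[setU/set0]_(j < n) I j) by exact: bigsetU_measurable.
have muU : mug g (\big[setU/set0]_(j < n) I j) =
           (\sum_(j < n) (g (t j) - g (s j)))%:E.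
  rewrite (@measure_bigsetU_ord _ _ _ (mug g) n xpredT I)//.
  rewrite -sumEFin; apply: eq_bigr => j _.
  have [? [? ?]] := st j.
  by apply: mug_itv => //; exact: ltW.
apply: le_lt_trans (rP _ mU _); last by rewrite muU lte_fin.
have ui j : `|u (t j) - u (s j)| <= \int[mug g]_(x in I j) `|p x|.
  have [as_ [sltt tb]] := st j.
  rewrite !uE ?as_ ?tb ?(le_trans as_ (ltW sltt)) ?(le_trans (ltW sltt) tb)//.
  rewrite opprD addrACA subrr add0r.
  rewrite (_ : prim p (t j) - prim p (s j) = \int[mug g]_(x in I j) p x).
    by apply: le_normr_Rintegral => //; exact: integrable_sub.
  rewrite !prim_def (_ : [set x | time x < t j] =
    [set x | time x < s j] `|` I j); last first.
    apply/seteqP; split => x; rewrite /I/= in_itv/=.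
      by move=> ->; rewrite andbT; case: (leP (s j) x); [right|left].
    by move=> [/lt_trans|/andP[]//]; apply.
  rewrite Rintegral_setU//.
  - by rewrite addrC addKr.
  - exact/measurable_tau_lt/measurable_time.
  - apply: integrable_sub => //; apply: measurableU => //.
    exact/measurable_tau_lt/measurable_time.
  apply/disj_setPS => x [/= xs]; rewrite /I/= in_itv/= => /andP[sx _].
  by have := lt_le_trans xs sx; rewrite ltxx.
apply: (@le_trans _ _ (\sum_(j < n) \int[mug g]_(x in I j) `|p x|)).
  exact: ler_sum.
by rewrite (Rintegral_bigsetU_ord mI tI (integrable_norm pi)).
Qed.

Lemma rlim_primitive (u : R -> R) c p t : integrableT p ->
  (forall t, a <= t <= b -> u t = c + prim p t) -> a <= t < b ->
  rlim u t = c + primc p t.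
Proof.
move=> pi uE /andP[at_ tb]; apply/cvg_lim => //.
have h : c + prim p s @[s --> t^'+] --> c + primc p t.
  by apply: cvgD; [exact: cvg_cst|exact: (prim_right_limit measurable_time pi)].
apply: cvg_trans h.
(* The formula for [u] holds only on [[a, b]]; since [t < b], points just to the right of [t] stay
   there. *)
apply: near_eq_cvg; near=> s; rewrite /= uE//; apply/andP; split.
  by apply: (le_trans at_); near: s; exact: nbhs_right_ge.
by near: s; exact: nbhs_right_le.
Unshelve. all: by end_near. Qed.

(** The mass of the point [t] is the jump of [g] there. Outside [J_g] it vanishes, so the level set
    separating [primc] from [prim] is null. *)
Lemma primc_notin_J_g p t : integrableT p -> a <= t < b -> ~ J_g g t ->
  primc p t = prim p t.
Proof.
move=> pi atb nJ; have /andP[at_ tb] := atb.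
have mt : measurable [set x | time x = t].
  exact: (measurable_tau_eq measurable_time).
pose r := \int[mugsf]_(x in [set x | time x = t]) (cst (1 : R) \_ D) x.
have rE : mugsf [set x | time x = t] = r%:E.
  rewrite /r (EFin_Rintegral mt integrable_one).
  rewrite (eq_integral (cst 1%E)); first by rewrite integral_cst// mul1e.
  by move=> x /set_mem/= xt; rewrite /patch mem_set//= in_itv/= -[x]/(time x) xt.
have r0 : r = 0.
  have r_ge0 : 0 <= r.
    by apply: Rintegral_ge0 => x _; rewrite /patch; case: ifP.
  apply/eqP; rewrite eq_le r_ge0 andbT leNgt.
  apply/negP => r_gt0; apply: nJ; split => //.
  have gt : g t = g a + prim (cst (1 : R) \_ D) t.
    by apply: prim_one; rewrite at_ ltW.
  rewrite (rlim_primitive integrable_one prim_one atb) gt.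
  rewrite (primcE measurable_time t integrable_one) -/r.
  by rewrite addrA [X in _ < X]addrC addKr.
rewrite (primcE measurable_time t pi) [X in _ + X](_ : _ = 0) ?addr0//.
rewrite /Rintegral null_set_integral//.
- apply/measurable_EFinP/(measurable_funS measurableT) => //.
  exact: (integrable_meas pi).
by move: rE; rewrite r0; apply.
Qed.

(** At a jump point the right limit of a primitive is [primc]; elsewhere [primc] and [prim] agree.
    One formula thus replaces both cases of [S_g]. *)
Lemma S_g_primitive (phi psi : R -> R[i]) t : is_D_g g phi psi -> a <= t < b ->
  complex.Re (S_g g phi t) =
    complex.Re (phi a) + primc ((fun s => complex.Re (psi s)) \_ D) t /\
  complex.Im (S_g g phi t) =
    complex.Im (phi a) + primc ((fun s => complex.Im (psi s)) \_ D) t.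
Proof.
move=> [[/L_g1P iRe /L_g1P iIm] phiE] atb; have /andP[at_ tb] := atb.
have ReE s : a <= s <= b -> complex.Re (phi s) =
    complex.Re (phi a) + prim ((fun s => complex.Re (psi s)) \_ D) s.
  by move=> asb; have /andP[_ sb] := asb; rewrite phiE// -int_gE//; case: (phi a).
have ImE s : a <= s <= b -> complex.Im (phi s) =
    complex.Im (phi a) + prim ((fun s => complex.Im (psi s)) \_ D) s.
  by move=> asb; have /andP[_ sb] := asb; rewrite phiE// -int_gE//; case: (phi a).
rewrite /S_g; case: asboolP => [_|nJ] /=.
  by rewrite (rlim_primitive iRe ReE)// (rlim_primitive iIm ImE).
have atb' : a <= t <= b by rewrite at_ ltW.
by rewrite !primc_notin_J_g// -ReE// -ImE.
Qed.

End stieltjes_primitive.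

(** * Weak solutions *)

Section weak_identity.
Context (R : realType) (a b : R) (g : derivator a b).
Hypothesis ab : a <= b.
Local Open Scope complex_scope.
Local Notation D := (`[a, b[%classic : set R).
Local Notation mu := (mugsf g).
Local Notation prim := (prim mu (@time _ _ _ g)).
Local Notation primc := (primc mu (@time _ _ _ g)).
Implicit Types u f p w q : R -> R.

Lemma Re_mul_real (x : R) (z : R[i]) :
  complex.Re (x%:C * z) = x * complex.Re z.
Proof. by case: z => zr zi; rewrite /= mul0r subr0. Qed.

Lemma Im_mul_real (x : R) (z : R[i]) :
  complex.Im (x%:C * z) = x * complex.Im z.
Proof. by case: z => zr zi; rewrite /= mul0r addr0. Qed.

Lemma complex_eq (z w : R[i]) : complex.Re z = complex.Re w ->
  complex.Im z = complex.Im w -> z = w.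
Proof. by case: z w => ? ? [? ?] /= -> ->. Qed.

Lemma ReD (z w : R[i]) : complex.Re (z + w) = complex.Re z + complex.Re w.
Proof. by case: z w => ? ? []. Qed.

Lemma ImD (z w : R[i]) : complex.Im (z + w) = complex.Im z + complex.Im w.
Proof. by case: z w => ? ? []. Qed.

Lemma ReB (z w : R[i]) : complex.Re (z - w) = complex.Re z - complex.Re w.
Proof. by case: z w => ? ? []. Qed.

Lemma ImB (z w : R[i]) : complex.Im (z - w) = complex.Im z - complex.Im w.
Proof. by case: z w => ? ? []. Qed.

Lemma eq_int_g (f h : R -> R) : (forall t, a <= t < b -> f t = h t) ->
  int_g g D f = int_g g D h.
Proof.
move=> fh; apply: eq_Rintegral => x /set_mem.
by rewrite /= in_itv/= => /fh.
Qed.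

Lemma Re_int_gC A (v : R -> R[i]) :
  complex.Re (int_gC g A v) = int_g g A (fun s => complex.Re (v s)).
Proof. by []. Qed.

Lemma Im_int_gC A (v : R -> R[i]) :
  complex.Im (int_gC g A v) = int_g g A (fun s => complex.Im (v s)).
Proof. by []. Qed.

(** Integration by parts: after expanding [w] and [q], the constants integrate directly and the two
    remaining integrals are those of [Rintegral_mul_split]. *)
Lemma weak_primitive_real w f c p e q : L_g g 1 f -> L_g g 1 p ->
  (forall t, a <= t <= b -> w t = c + prim (f \_ D) t) ->
  (forall t, a <= t < b -> q t = e + primc (p \_ D) t) ->
  int_g g D (fun s => w s * p s) + int_g g D (fun s => f s * q s) =
  w b * (e + prim (p \_ D) b) - c * e.
Proof.
move=> /L_g1P fi /L_g1P pi wE qE.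
have D0 h x : ~ D x -> (h \_ D : R -> R) x = 0.
  by move=> Dx; rewrite /patch memNset.
have atbD x : D x -> a <= x < b by rewrite /= in_itv.
rewrite !int_g_total wE ?ab ?lexx//.
rewrite !prim_total; [|exact: D0|exact: D0].
have fp := Rintegral_mul_split (@measurable_time _ _ _ g) fi pi.
have i1 := integrable_mul_prim (@measurable_time _ _ _ g) pi fi.
have i2 := integrable_mul_primc (@measurable_time _ _ _ g) fi pi.
have E1 : \int[mu]_x ((fun s => w s * p s) \_ D) x =
    c * (\int[mu]_x (p \_ D) x) + \int[mu]_x ((p \_ D) x * prim (f \_ D) x).
  rewrite -(RintegralZl c measurableT pi).
  rewrite -(RintegralD measurableT (integrable_scale c pi) i1).
  apply: eq_Rintegral => x _; rewrite /patch; case: ifPn => [/set_mem Dx|_].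
    have /andP[ax /ltW xb] := atbD _ Dx.
    by rewrite wE ?ax// mulrDl [X in _ + X]mulrC.
  by rewrite mulr0 mul0r addr0.
have E2 : \int[mu]_x ((fun s => f s * q s) \_ D) x =
    e * (\int[mu]_x (f \_ D) x) + \int[mu]_x ((f \_ D) x * primc (p \_ D) x).
  rewrite -(RintegralZl e measurableT fi).
  rewrite -(RintegralD measurableT (integrable_scale e fi) i2).
  apply: eq_Rintegral => x _; rewrite /patch; case: ifPn => [/set_mem Dx|_].
    by rewrite qE ?atbD// mulrDr [X in X + _]mulrC.
  by rewrite mulr0 mul0r addr0.
rewrite E1 E2.
set A := \int[mu]_x ((f \_ D) x) in fp *.
set B := \int[mu]_x ((p \_ D) x) in fp *.
have -> : (c + A) * (e + B) - c * e = c * B + e * A + A * B by ring.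
by rewrite fp addrACA; congr (_ + _); exact: addrC.
Qed.

(** As [w] and [f] are real, the identity splits into its real and imaginary parts. *)
Lemma weak_primitive w f c phi psi : L_g g 1 f ->
  (forall t, a <= t <= b -> w t = c + prim (f \_ D) t) ->
  is_D_g g phi psi ->
  int_gC g D (fun s => (w s)%:C * psi s) +
  int_gC g D (fun s => (f s)%:C * S_g g phi s) =
  (w b)%:C * phi b - c%:C * phi a.
Proof.
move=> fi wE phiD; have SE t := S_g_primitive ab phiD (t := t).
have [[Rei Imi] phiE] := phiD.
rewrite [phi b]phiE ?ab ?lexx//; apply: complex_eq.
  rewrite !ReB !ReD !Re_mul_real ReD !Re_int_gC int_gE//.
  rewrite (eq_int_g (fun t _ => Re_mul_real (w t) (psi t))).
  rewrite (eq_int_g (fun t _ => Re_mul_real (f t) (S_g g phi t))).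
  by apply: weak_primitive_real => // t /SE[].
rewrite !ImB !ImD !Im_mul_real ImD !Im_int_gC int_gE//.
rewrite (eq_int_g (fun t _ => Im_mul_real (w t) (psi t))).
rewrite (eq_int_g (fun t _ => Im_mul_real (f t) (S_g g phi t))).
by apply: weak_primitive_real => // t /SE[].
Qed.

End weak_identity.

(** * Test functions, and recovery of a primitive from the weak identity *)

Section test_functions.
Context (R : realType) (a b : R) (g : derivator a b).
Hypothesis ab : a <= b.
Local Open Scope complex_scope.
Local Notation D := (`[a, b[%classic : set R).
Local Notation mu := (mugsf g).
Local Notation integrableT f := (mu.-integrable setT (EFin \o f)).
Local Notation prim := (prim mu (@time _ _ _ g)).
Local Notation mfun f :=
  (measurable_fun (setT : set (stieltjes_type g)) (f : stieltjes_type g -> R)).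
Implicit Types u v f p w q : R -> R.

Lemma patch_mul_one p : p \_ D = (fun x => (cst (1 : R) \_ D) x * (p \_ D) x).
Proof. by apply/funext => x; rewrite /patch; case: ifP; rewrite ?mul1r ?mul0r. Qed.

Lemma bounded_L_g1 p M : mfun (p \_ D) -> (forall x, `|(p \_ D) x| <= M) ->
  L_g g 1 p.
Proof.
move=> mp pM; apply/L_g1P; rewrite patch_mul_one.
exact: (integrable_mul_bounded (integrable_one g ab) mp pM).
Qed.

Lemma bounded_L_gy p M : mfun (p \_ D) -> (forall x, `|(p \_ D) x| <= M) ->
  L_g g +oo p.
Proof.
move=> mp pM; rewrite /L_g inE/=; apply/andP; split; first by rewrite inE.
rewrite inE/= /finite_norm Lnorm.unlock/=; case: ifPn => _; last exact: ltry.
apply: (@le_lt_trans _ _ M%:E); last exact: ltry.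
by apply/ess_supP; apply: aeW => x /=; rewrite lee_fin.
Qed.

Lemma int_g0 A : int_g g A (fun=> 0) = 0.
Proof. by rewrite /int_g /Rintegral integral0. Qed.

(** Real test functions are admissible over both scalar fields, so arguments using only these treat
    the two values of [K] at once. *)
Lemma test_function K p M c0 : mfun (p \_ D) -> (forall x, `|(p \_ D) x| <= M) ->
  let phi := fun t => (c0 + int_g g `[a, t[ p)%:C in
  [/\ T_g g K phi, is_D_g g phi (fun t => (p t)%:C) & phi a = c0%:C].
Proof.
move=> mp pM phi.
have real_scalars x : scalars K (x%:C : R[i]) by case: K.
have z0 : (fun=> 0 : R) \_ D = cst 0.
  by apply/funext => x; rewrite /patch; case: ifP.
have m0 : mfun ((fun=> 0 : R) \_ D) by rewrite z0.
have b0 x : `|((fun=> 0 : R) \_ D) x| <= 0 by rewrite z0 normr0.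
have intC A : int_gC g A (fun t => (p t)%:C) = (int_g g A p)%:C.
  by apply: complex_eq => //; exact: (int_g0 A).
have phia : phi a = c0%:C.
  rewrite /phi (_ : `[a, a[%classic = set0 :> set R); last first.
    by apply/seteqP; split => x //=; rewrite in_itv/= => /andP[/le_lt_trans h /h]; rewrite ltxx.
  by rewrite /int_g Rintegral_set0 addr0.
split => //.
- exists c0%:C, (fun t => (p t)%:C); split => //.
    by split; [exact: bounded_L_gy mp pM|exact: bounded_L_gy m0 b0].
  by move=> t _; rewrite intC -rmorphD.
- split; first by split; [exact: bounded_L_g1 mp pM|exact: bounded_L_g1 m0 b0].
  by move=> t _; rewrite phia intC -rmorphD.
Qed.

(** Equality of the final traces is not assumed: it comes out of the constant test function, before
    the comparison of [v] with [w]. *)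
Lemma weak_solution_eq_primitive K v f w c ub : L_g g 1 v -> L_g g 1 f ->
  (forall t, a <= t <= b -> w t = c + prim (f \_ D) t) ->
  (forall phi, T_g g K phi -> forall psi, is_D_g g phi psi ->
     int_gC g D (fun s => (v s)%:C * psi s) +
     int_gC g D (fun s => (f s)%:C * S_g g phi s) =
     ub%:C * phi b - c%:C * phi a) ->
  exists N : set (stieltjes_type g), [/\ measurable N, mu N = 0%E &
    forall x, ~ N x -> a <= x < b -> v x = w x].
Proof.
move=> vi fi wE weak.
(* Subtracting the identities of [v] and [w] cancels the terms in [f] and the initial traces; the
   last factor is the value at [b] of the test function. *)
have key p M c0 : mfun (p \_ D) -> (forall x, `|(p \_ D) x| <= M) ->
    int_g g D (fun s => v s * p s) - int_g g D (fun s => w s * p s) =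
    (ub - w b) * (c0 + int_g g D p).
  move=> mp pM; have [phiT phiD phia] := test_function K c0 mp pM.
  have := weak _ phiT _ phiD; have := weak_primitive ab fi wE phiD.
  rewrite phia.
  set S := int_gC _ _ (fun s => (f s)%:C * _).
  move=> wp vp; have {wp vp} : int_gC g D (fun s => (v s)%:C * (p s)%:C) -
      int_gC g D (fun s => (w s)%:C * (p s)%:C) =
      (ub%:C - (w b)%:C) * (c0 + int_g g D p)%:C.
    by rewrite mulrBl; move: wp vp; set P := _%:C * _%:C; move=> wp vp;
      apply: (addIr S); rewrite addrAC vp -(addrK S (int_gC _ _ _)) wp; ring.
  move/(congr1 (@complex.Re R)); rewrite ReB !Re_int_gC -rmorphB Re_mul_real/=.
  rewrite (eq_int_g g (fun t _ => Re_mul_real (v t) (p t)%:C)).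
  by rewrite (eq_int_g g (fun t _ => Re_mul_real (w t) (p t)%:C)).
have z0 : (fun=> 0 : R) \_ D = cst 0.
  by apply/funext => x; rewrite /patch; case: ifP.
have b0 x : `|((fun=> 0 : R) \_ D) x| <= 0 by rewrite z0 normr0.
have m0 : mfun ((fun=> 0 : R) \_ D) by rewrite z0.
have mul0 h : int_g g D (fun s => h s * 0) = 0.
  by rewrite (_ : (fun s => _) = fun=> 0) ?int_g0//; apply/funext => s; rewrite mulr0.
(* The test function 1, that is [p = 0] and [c0 = 1]. *)
have ubE : ub - w b = 0.
  have := key (fun=> 0) 0 1 m0 b0.
  by rewrite !mul0 subrr int_g0 addr0 mulr1 => ->.
pose z x := (v \_ D) x - (w \_ D) x.
have wi : integrableT (w \_ D).
  have fi' : integrableT (f \_ D) by exact/L_g1P.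
  have mt := @measurable_time _ _ _ g.
  (* On [[a, b[] the function [w] is a constant plus a bounded primitive; the cut constant 1 makes
     both terms integrable. *)
  rewrite (_ : w \_ D = fun x : stieltjes_type g => c * (cst (1 : R) \_ D) x +
    (cst (1 : R) \_ D) x * prim (f \_ D) (@time _ _ _ g x)).
    apply: integrable_add; first exact/integrable_scale/integrable_one.
    exact: (integrable_mul_prim mt (integrable_one g ab) fi').
  apply/funext => x; rewrite /patch; case: ifPn => [/set_mem|_].
    by rewrite /= in_itv/= => /andP[ax /ltW xb]; rewrite mulr1 mul1r wE ?ax.
  by rewrite mulr0 mul0r addr0.
have {}vi : integrableT (v \_ D) by exact/L_g1P.
have zi : integrableT z by exact: (integrableB measurableT vi wi).
have mz := integrable_meas zi.
(* With equal final traces the right side of [key] is 0, so testing with this sign gives a zero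
   integral for the absolute value of [z]. *)
pose p x : R := if 0 <= z x then 1 else -1.
have mp : mfun (p \_ D).
  rewrite (_ : p \_ D = fun x => (cst (1 : R) \_ D) x * p x); last first.
    by apply/funext => x; rewrite /patch; case: ifP; rewrite ?mul1r ?mul0r.
  apply: measurable_funM; first exact: (integrable_meas (integrable_one g ab)).
  exact: measurable_sign mz.
have pM x : `|(p \_ D) x| <= 1.
  by rewrite /patch /p; case: ifP => _; rewrite ?normr0//; case: ifP; rewrite ?normrN1 ?normr1.
have := key p 1 0 mp pM; rewrite ubE mul0r !int_g_total.
have pE u : (fun s => u s * p s) \_ D = fun x => (u \_ D) x * (p \_ D) x.
  by apply/funext => x; rewrite /patch; case: ifP; rewrite ?mul0r.
rewrite !pE -RintegralB//; last 2 first.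
- exact: (integrable_mul_bounded vi mp pM).
- exact: (integrable_mul_bounded wi mp pM).
have zE x : (v \_ D) x * (p \_ D) x - (w \_ D) x * (p \_ D) x = `|z x|.
  rewrite -mulrBl -/(z x) /patch; case: ifPn => [_|/negPf xD].
    rewrite /p; case: ifPn => [/ger0_norm->|]; first by rewrite mulr1.
    by rewrite -ltNge => /ltr0_norm->; rewrite mulrN1.
  by rewrite /z /patch xD subrr mul0r normr0.
under eq_Rintegral do rewrite zE.
move=> z1; have : (\int[mu]_x `|(EFin \o z) x|)%E = 0%E.
  by rewrite -(EFin_Rintegral measurableT (integrable_norm zi)) /= z1.
have mEz := measurable_int mu zi.
move/(ae_eq_integral_abs mu measurableT mEz) => [N [mN N0 Nz]].
exists N; split => // x Nx axb; apply: contrapT => vw; apply: Nx; apply: Nz => /=.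
move=> /(_ I) [] /eqP; rewrite /z /patch mem_set ?subr_eq0//=.
  by move/eqP.
Qed.

End test_functions.

(** * Well-posedness *)

Lemma enorm_le_l1norm (R : realType) n (v : 'rV[R]_n) : enorm v <= l1norm v.
Proof.
rewrite -[leRHS](ger0_norm (l1norm_ge0 v)) -sqrtr_sqr /enorm ler_wsqrtr//.
rewrite /l1norm expr2 mulr_suml; apply: ler_sum => i _.
by rewrite -real_normK ?num_real// expr2 ler_wpM2l// l1norm_coord.
Qed.

(** Each coordinate is at most the Euclidean norm. The crude factor [n] is harmless, being absorbed
    into the integrable bounds. *)
Lemma l1norm_le_enorm (R : realType) n (v : 'rV[R]_n) :
  l1norm v <= n%:R * enorm v.
Proof.
apply: l1norm_le => i; rewrite -sqrtr_sqr ler_wsqrtr// (bigD1 i)//= lerDl.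
by apply: sumr_ge0 => j _; exact: sqr_ge0.
Qed.

(** * Vector functions extended by zero outside [[a, b[] *)

Section cutoff.
Context (R : realType) (a b : R) (g : derivator a b) (n : nat).
Local Notation D := (`[a, b[%classic : set R).
Local Notation mu := (mugsf g).
Local Notation integrableT f := (mu.-integrable setT (EFin \o f)).
Local Notation prim := (prim mu (@time _ _ _ g)).
Local Notation vprim := (vprim mu (@time _ _ _ g)).
Implicit Types (f h : R -> 'rV[R]_n) (N : set (stieltjes_type g)).

Definition vcut f : stieltjes_type g -> 'rV[R]_n :=
  fun x => \row_i ((fun s => f s 0 i) \_ D) x.

Lemma L_gVP f : L_gV g 1 f <-> forall i, integrableT (fun x => vcut f x 0 i).
Proof.
have E i : (fun x => vcut f x 0 i) = (fun s => f s 0 i) \_ D.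
  by apply/funext => x; rewrite mxE.
by split=> H i; [rewrite E; exact/L_g1P|apply/L_g1P; rewrite -E].
Qed.

Lemma int_gVE f t : t <= b -> int_gV g `[a, t[ f = vprim (vcut f) t.
Proof.
move=> tb; apply/rowP => i; rewrite [LHS]mxE [RHS]mxE (int_gE g _ tb).
by apply: eq_prim => x _; rewrite mxE.
Qed.

Lemma vcut_in f x : D x -> vcut f x = f x.
Proof. by move=> Dx; apply/rowP => i; rewrite mxE /patch mem_set. Qed.

Lemma vcut_notin f x : ~ D x -> vcut f x = 0.
Proof. by move=> Dx; apply/rowP => i; rewrite !mxE /patch memNset. Qed.

Lemma vprim_coord (c : 'rV[R]_n) f i t :
  (c + vprim (vcut f) t) 0 i = c 0 i + prim ((fun s => f s 0 i) \_ D) t.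
Proof. by rewrite !mxE; congr (_ + _); apply: eq_prim => x _; rewrite mxE. Qed.

Lemma vprim_eq_off_null N (f h : stieltjes_type g -> 'rV[R]_n) t :
  measurable N -> mu N = 0%E -> (forall x, ~ N x -> f x = h x) ->
  (forall i, integrableT (fun x => h x 0 i)) -> vprim f t = vprim h t.
Proof.
move=> mN N0 fh hi; apply/rowP => i; rewrite !mxE.
have mt := measurable_tau_lt (@measurable_time _ _ _ g) t.
apply: (Rintegral_eq_off_null (@mug_complete _ _ _ g) mN N0 mt).
  by move=> x Nx; rewrite fh.
exact: integrable_meas (hi i).
Qed.

Lemma integrable_vec_eq_off_null N (f h : stieltjes_type g -> 'rV[R]_n) :
  measurable N -> mu N = 0%E -> (forall x, ~ N x -> f x = h x) ->
  (forall i, integrableT (fun x => h x 0 i)) ->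
  forall i, integrableT (fun x => f x 0 i).
Proof.
move=> mN N0 fh hi i.
apply: (integrable_eq_off_null (@mug_complete _ _ _ g) mN N0 _ (hi i)).
by move=> x Nx; rewrite fh.
Qed.

End cutoff.

(** * Reduction to a right-hand side that is regular everywhere *)

Section initial_value_problem.
Context (R : realType) (a b : R) (g : derivator a b) (n : nat).
Local Notation D := (`[a, b[%classic : set R).
Local Notation mu := (mugsf g).
Local Notation integrableT f := (mu.-integrable setT (EFin \o f)).
Local Notation vprim := (vprim mu (@time _ _ _ g)).
Let mtime := @measurable_time _ _ _ g.

Variables (F : R -> 'rV[R]_n -> 'rV[R]_n) (m L : R -> R).
Variable N : set (stieltjes_type g).
Hypotheses (mN : measurable N) (N0 : mu N = 0%E).
Hypothesis Fmeas : forall (x : 'rV[R]_n) (i : 'I_n),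
  measurable_fun (`[a, b[%classic : set (stieltjes_type g)) (fun t => F t x 0 i).
Hypotheses (mi : L_g g 1 m) (Li : L_g g 1 L).
Hypothesis mL0 : forall t, a <= t < b -> 0 <= m t /\ 0 <= L t.
Hypothesis F0 : forall t, ~ N t -> a <= t < b -> enorm (F t 0) <= m t.
Hypothesis FL : forall t, ~ N t -> a <= t < b ->
  forall x y, enorm (F t x - F t y) <= L t * enorm (x - y).

Definition good_times : set (stieltjes_type g) := D `\` N.

(** The bounds on [F] hold only off [N] and inside [[a, b[], whereas Picard iteration asks for them
    everywhere. Setting [F] to zero at the other times leaves the primitives of the cut right-hand
    side unchanged. *)
Definition regular_rhs (t : stieltjes_type g) (v : 'rV[R]_n) : 'rV[R]_n :=
  if t \in good_times then F t v else 0.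

(** The factor [n] pays for the passage from the Euclidean norm to [l1norm]. *)
Let m' (t : stieltjes_type g) : R := n%:R * (m \_ D) t.
Let L' (t : stieltjes_type g) : R := n%:R * (L \_ D) t.

Let mi' : integrableT m'.
Proof. by apply: integrable_scale; apply/L_g1P. Qed.

Let Li' : integrableT L'.
Proof. by apply: integrable_scale; apply/L_g1P. Qed.

Let patch_ge0 (h : R -> R) t : (a <= t < b -> 0 <= h t) -> 0 <= (h \_ D) t.
Proof.
by rewrite /patch; case: ifPn => // /set_mem; rewrite /= in_itv/= => tD; apply.
Qed.

Let L'0 t : 0 <= L' t.
Proof. by rewrite mulr_ge0// patch_ge0// => /mL0[]. Qed.

Let m'0 t : 0 <= m' t.
Proof. by rewrite mulr_ge0// patch_ge0// => /mL0[]. Qed.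

Let good_timesP t : t \in good_times -> [/\ D t, ~ N t & a <= t < b].
Proof. by move=> /set_mem[Dt Nt]; split => //; move: Dt; rewrite /= in_itv. Qed.

Let mF' v i : measurable_fun setT (fun t => regular_rhs t v 0 i).
Proof.
have mG : measurable good_times.
  by apply: measurableD => //; exact: measurable_itv_stieltjes.
rewrite (_ : (fun t => _) =
    (fun t : stieltjes_type g => F t v 0 i) \_ good_times); last first.
  by apply/funext => t; rewrite /regular_rhs /patch; case: ifP; rewrite ?mxE.
apply/(measurable_restrictT _ mG).1.
apply: measurable_funS (Fmeas v i); first exact: measurable_itv_stieltjes.
by move=> t [].
Qed.

Let F'0 t : l1norm (regular_rhs t 0) <= m' t.
Proof.
rewrite /regular_rhs; case: ifPn => [/good_timesP[Dt Nt tab]|_].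
  rewrite (le_trans (l1norm_le_enorm _))// /m' /patch mem_set// ler_wpM2l//.
  exact: F0.
by rewrite l1norm0 m'0.
Qed.

Let F'L t v w :
  l1norm (regular_rhs t v - regular_rhs t w) <= L' t * l1norm (v - w).
Proof.
rewrite /regular_rhs; case: ifPn => [/good_timesP[Dt Nt tab]|_].
  rewrite (le_trans (l1norm_le_enorm _))// /L' /patch mem_set// -mulrA ler_wpM2l//.
  rewrite (le_trans (FL Nt tab v w))// ler_wpM2l ?enorm_le_l1norm//.
  by have [] := mL0 tab.
by rewrite subrr l1norm0 mulr_ge0// l1norm_ge0.
Qed.

Lemma vcut_rhs (V : R -> 'rV[R]_n) t : ~ N t ->
  vcut (g := g) (fun s => F s (V s)) t = regular_rhs t (V t).
Proof.
move=> Nt; rewrite /regular_rhs; case: ifPn => [/good_timesP[Dt _ _]|/negP nt].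
  exact: vcut_in.
by apply: vcut_notin => Dt; apply: nt; exact/mem_set.
Qed.

Variable u0 : 'rV[R]_n.

(** The last clause serves both uniqueness claims. It compares the primitive [Y], not [V], with [X],
    since a weak solution is determined only almost everywhere while [Y] is a true fixed point. *)
Lemma solution_exists : exists X : R -> 'rV[R]_n,
  [/\ bounded_measurable X,
      L_gV g 1 (fun s => F s (X s)),
      forall t, X t = u0 + vprim (vcut (g := g) (fun s => F s (X s))) t &
      forall (V : R -> 'rV[R]_n) (N' : set (stieltjes_type g)),
        measurable N' -> mu N' = 0%E -> L_gV g 1 (fun s => F s (V s)) ->
        let Y t := u0 + vprim (vcut (g := g) (fun s => F s (V s))) t in
        (forall t, ~ N' t -> a <= t < b -> V t = Y t) ->
        forall t, Y t = X t].
Proof.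
have [X bX XE] := picard_exists mtime mi' Li' L'0 mF' F'0 F'L u0.
have iX i := integrable_rhs mtime mi' Li' L'0 mF' F'0 F'L i bX.
have cX t : ~ N t -> vcut (g := g) (fun s => F s (X s)) t =
    regular_rhs t (X (time t)) by exact: vcut_rhs.
exists X; split => //.
- by apply/L_gVP; exact: (integrable_vec_eq_off_null mN N0 cX iX).
- by move=> t; rewrite [LHS]XE /picard (vprim_eq_off_null t mN N0 cX iX).
move=> V N' mN' N'0 /L_gVP iV Y VY.
have bY : bounded_measurable Y by exact: (vprim_bounded_measurable mtime u0 iV).
have iY i := integrable_rhs mtime mi' Li' L'0 mF' F'0 F'L i bY.
have mU : measurable (N `|` N') by exact: measurableU.
have U0 : mu (N `|` N') = 0%E by rewrite null_set_setU.
apply: (picard_unique mtime mi' Li' L'0 mF' F'0 F'L bY bX _ XE).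
(* Off the union of the null sets, [V] may be replaced by [Y] inside the regularized right-hand
   side, which makes [Y] a fixed point of [picard]. *)
move=> t; rewrite [LHS]/Y /picard (vprim_eq_off_null t mU U0 _ iY)//.
move=> s /not_orP[Ns N's]; rewrite vcut_rhs//.
rewrite /regular_rhs; case: ifPn => // /good_timesP[_ _ sab].
by rewrite VY.
Qed.

End initial_value_problem.

Theorem theorem6p5 (K : base_field) (R : realType) (a b : R) (hab : a < b)
  (g : derivator a b) (hg : 0 < g b - g a) (d : nat)
  (F : R -> 'rV[R]_d -> 'rV[R]_d)
  (Fmeas : forall (x : 'rV[R]_d) (i : 'I_d),
     measurable_fun (`[a, b[%classic : set (stieltjes_type g))
       (fun t => F t x 0 i))
  (Fcont : {ae mug g, forall t : R, a <= t < b -> continuous (F t)})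
  (Flip : exists m L : R -> R,
     [/\ L_g g 1 m /\ L_g g 1 L,
         (forall t, a <= t < b -> 0 <= m t /\ 0 <= L t),
         {ae mug g, forall t : R, a <= t < b -> enorm (F t 0) <= m t} &
         {ae mug g, forall t : R, a <= t < b -> forall x y : 'rV[R]_d,
            enorm (F t x - F t y) <= L t * enorm (x - y)}])
  (u0 : 'rV[R]_d) :
  exists U : R -> 'rV[R]_d,
    [/\ integral_solution g F u0 U,
        (forall V : R -> 'rV[R]_d, integral_solution g F u0 V ->
           forall t, a <= t <= b -> V t = U t),
        weak_solution g K F U u0 (U b) &
        (forall v : R -> 'rV[R]_d, weak_solution g K F v u0 (U b) ->
           {ae mug g, forall t : R, a <= t < b -> v t = U t})].

Proof.
have ab : a <= b := ltW hab.
have mtime := @measurable_time _ _ _ g.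
case: Flip => m [L [[mi Li] mL0 ae0 aeL]].
(* A single null set outside which both the growth and the Lipschitz bounds hold. *)
have [N [mN N0 subN]] := negligibleU ae0 aeL.
have F0 (t : stieltjes_type g) : ~ N t -> a <= t < b -> enorm (F t 0) <= m t.
  by move=> Nt; apply: contrapT => h; apply/Nt/subN; left.
have FL (t : stieltjes_type g) : ~ N t -> a <= t < b ->
    forall x y, enorm (F t x - F t y) <= L t * enorm (x - y).
  by move=> Nt; apply: contrapT => h; apply/Nt/subN; right.
have [X [bX iX XE uniqX]] := solution_exists mN N0 Fmeas mi Li mL0 F0 FL u0.
have XiE i t : a <= t <= b -> X t 0 i =
    u0 0 i + prim (mugsf g) (@time _ _ _ g) ((fun s => F s (X s) 0 i) \_ `[a, b[) t.
  by move=> _; rewrite {1}XE vprim_coord.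
exists X; split.
- split; [|exact: iX|].
    move=> i; apply: (AC_g_primitive _ (XiE i)); exact/L_g1P/iX.
  by move=> t /andP[_ tb]; rewrite {1}XE (int_gVE _ _ tb).
- move=> V [_ iV VE] t tab.
  (* An integral solution equals its own primitive at every time of [[a, b[], so any null set fits
     as the exceptional one. Going through the primitive also reaches [t = b]. *)
  rewrite -(uniqX V N mN N0 iV).
    by have /andP[_ tb] := tab; rewrite (VE t tab) (int_gVE _ _ tb).
  move=> s _ /andP[as_ /ltW sb]; have sab : a <= s <= b by rewrite as_.
  by rewrite (VE s sab) (int_gVE _ _ sb).
- split; [|exact: iX|].
    (* [X] is bounded and measurable and the mass of [[a, b[] is finite, hence integrability. *)
    move=> i; have [mX [M XM]] := bX; apply: (@bounded_L_g1 _ _ _ _ ab _ M).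
      rewrite (_ : _ \_ _ = fun t : stieltjes_type g =>
        (cst (1 : R) \_ `[a, b[) t * X (time t) 0 i); last first.
        by apply/funext => t; rewrite /patch; case: ifP; rewrite ?mul1r ?mul0r.
      apply: measurable_funM; first exact: (integrable_meas (integrable_one g ab)).
      exact: (measurableT_comp (mX i) mtime).
    move=> t; rewrite /patch; case: ifP => _.
      exact: le_trans (l1norm_coord _ i) (XM t).
    by rewrite normr0 (le_trans (l1norm_ge0 _) (XM t)).
  by move=> phi _ psi phiD i; exact: weak_primitive (iX i) (XiE i) phiD.
- move=> v [iv iF weak].
  pose Y t := u0 + vprim (mugsf g) (@time _ _ _ g) (vcut (g := g) (fun s => F s (v s))) t.
  have vY : {ae mug g, forall t i, a <= t < b -> v t 0 i = Y t 0 i}.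
    (* Each coordinate has its own null set; finitely many coordinates leave a common one. *)
    apply: filter_forall => i.
    have YiE t : a <= t <= b -> Y t 0 i = u0 0 i +
        prim (mugsf g) (@time _ _ _ g) ((fun s => F s (v s) 0 i) \_ `[a, b[) t.
      by move=> _; exact: vprim_coord.
    have [N1 [mN1 N10 vYi]] := weak_solution_eq_primitive ab (iv i) (iF i) YiE
      (fun phi phiT psi phiD => weak phi phiT psi phiD i).
    by exists N1; split => // t /= h; apply: contrapT => /vYi.
  have [N' [mN' N'0 subN']] := vY.
  have vY' (t : stieltjes_type g) : ~ N' t -> a <= t < b -> v t = Y t.
    move=> Nt tab; apply/rowP => i; apply: contrapT => h; apply/Nt/subN' => /=.
    by move=> /(_ i tab).
  (* The primitive [Y] built from [v] is the solution, and [v] equals [Y] off [N']. *)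
  have YX := uniqX v N' mN' N'0 iF vY'.
  exists N'; split => // t /= h; apply: contrapT => Nt; apply: h => tab.
  by rewrite -YX; exact: vY'.
Qed.
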